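(* Let $G$ be a finite solvable group. Then the power graph of $G$ is a cograph if and only if one of the following holds (different letters among $p,q,r,s$ in each item denote pairwise distinct primes, and $n,m,k\ge 0$ are integers): (1) $G$ has prime power order. (2) $G\cong (C_p\rtimes C_{q^n})\times C_q$, and if $n>0$ then $C_{q^n}$ acts fixed-point-freely on the $C_p$-part of $\mathrm{Fit}(G)$. (3) $G\cong C_{pq}\rtimes C_{r^n}$, and if $n>0$ then $C_{r^n}$ acts fixed-point-freely on $C_{pq}$ (thus $r^n$ divides $q-1$ and $p-1$). (4) $G\cong C_{rs}\rtimes C_{pq}$, where $pq$ divides $r-1$ and $s-1$ and $C_{pq}$ acts fixed-point-freely on $C_{rs}$. (5) $F:=\mathrm{Fit}(G)$ is an $r$-group for some prime $r$, and $H:=G/F$ is in one of the following three cases: (a) $H$ is a generalized quaternion $2$-group acting without fixed points on $F$. (b) $F$ admits a group of fixed-point-free automorphisms $P\cong C_{p^k}$ for a prime $p\ne r$, and $H$ is (isomorphic to) a subgroup of a semidirect product $P\rtimes C_{r^m}$, where the elements of $H$ lying in $P$ act on $F$ by conjugation as the corresponding automorphisms in $P$; the action of $C_{r^m}$ on $P$ is fixed-point-free if $m>0$. (c) $F$ admits a group of fixed-point-free automorphisms $C\cong C_{pq}$ for primes $p\ne q$ with $p,q\ne r$, and $H$ is (isomorphic to) a subgroup of a semidirect product $C\rtimes C_{r^m}$, where the elements of $H$ lying in $C$ act on $F$ by conjugation as the corresponding automorphisms in $C$; the action of $C_{r^m}$ on $C$ is fixed-point-free if $m>0$.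
   Context: The power graph $\mathrm{Pow}(G)$ of a group $G$ is the undirected graph with vertex set $G$ in which two distinct elements $g,h$ are joined by an edge iff $g^n=h$ or $h^n=g$ for some $n\in\mathbb{N}$. A cograph is a graph with no induced path on four vertices $P_4$. $C_n$ denotes the cyclic group of order $n$. $\mathrm{Fit}(G)$ is the Fitting subgroup, the largest normal nilpotent subgroup of $G$. An automorphism of a group $K$ is fixed-point-free if it fixes only the identity of $K$; a group acts fixed-point-freely (without fixed points) on $K$, respectively is a group of fixed-point-free automorphisms of $K$, if every non-trivial element of it acts as a fixed-point-free automorphism of $K$. For a normal subgroup $N$ of $G$, $G/N$ acts fixed-point-freely on $N$ if, for every $g\in G\setminus N$, conjugation by $g$ fixes only the identity of $N$. *)

(* Defs.v *)
From HB Require Import structures.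
From mathcomp Require Import all_boot all_fingroup all_solvable.

Set Implicit Arguments.
Unset Strict Implicit.
Unset Printing Implicit Defensive.

Import GroupScope.

Definition pow_adj (gT : finGroupType) (x y : gT) : Prop :=
  x <> y /\ ((exists n : nat, x ^+ n = y) \/ (exists n : nat, y ^+ n = x)).

Definition induced_P4 (T : eqType) (adj : T -> T -> Prop) (a b c d : T) : Prop :=
  uniq [:: a; b; c; d] /\
  [/\ adj a b, adj b c & adj c d] /\ [/\ ~ adj a c, ~ adj a d & ~ adj b d].

Definition cograph (T : finType) (V : {set T}) (adj : T -> T -> Prop) : Prop :=
  ~ exists a b c d : T,
      [/\ a \in V, b \in V, c \in V & d \in V] /\ induced_P4 adj a b c d.

Definition distinct_primes (s : seq nat) : bool := all prime s && uniq s.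

Definition cyclic_of_order (gT : finGroupType) (A : {group gT}) (n : nat) : bool :=
  cyclic A && (#|A| == n).

Section Cases.
Variable gT : finGroupType.
Implicit Types (G N : {group gT}) (p q r s n m : nat).

Definition has_prime_power_order G : Prop :=
  exists p k : nat, prime p /\ #|G| = (p ^ k)%N.

(* [semiregular K Q] says that every nontrivial element of [Q] centralises only
   the identity of [K]: conjugation by [Q] is a fixed-point-free action. *)
Definition case_pq_times_q G p q n : Prop :=
  exists K Q L Z : {group gT},
    [/\ cyclic_of_order K p, cyclic_of_order Q (q ^ n)%N & K ><| Q = L] /\
    [/\ cyclic_of_order Z q, L \x Z = G
      & (0 < n)%N -> semiregular 'O_p('F(G)) Q].

Definition case_pq_by_r G p q r n : Prop :=
  exists K Q : {group gT},
    [/\ cyclic_of_order K (p * q)%N, cyclic_of_order Q (r ^ n)%N, K ><| Q = G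
      & (0 < n)%N -> semiregular K Q].

Definition case_rs_by_pq G p q r s : Prop :=
  [/\ (p * q %| r - 1)%N, (p * q %| s - 1)%N
    & exists K Q : {group gT},
        [/\ cyclic_of_order K (r * s)%N, cyclic_of_order Q (p * q)%N,
            K ><| Q = G & semiregular K Q]].

(* The action of [G / N] on [N] has to be expressed with representatives in [G]. *)
Definition quotient_acts_fpf G N : Prop :=
  {in G :\: N, forall g, 'C_N[g] = 1}.

Definition case_quaternion G : Prop :=
  (exists n : nat, (2 < n)%N /\ (G / 'F(G)) \isog 'Q_(2 ^ n)%N) /\
  quotient_acts_fpf G 'F(G)%G.

Definition fpf_automorphism_group N (A : {group {perm gT}}) : Prop :=
  A \subset Aut N /\
  {in A^#, forall a : {perm gT}, {in N, forall x, a x = x -> x = 1}}.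

(* [F := 'F(G)] admits a cyclic group [A] of [n] fixed-point-free automorphisms,
   [L = K ><| R] is the semidirect product, with [psi] identifying [A] with [K]
   and [R] cyclic of order [r ^ m], and [phi] embeds [G / F] in [L].
   Conjugation by [g] in [G] restricts to an automorphism of [F] that depends
   on the coset of [g] up to inner automorphisms of [F] ([F] need not be
   abelian), so that an element [h] of [G / F] "acts as [a]" when some
   representative of [h] does. *)
Definition case_cyclic_fpf G r n m : Prop :=
  let F := 'F(G)%G in
  exists A : {group {perm gT}},
    [/\ fpf_automorphism_group F A, cyclic_of_order A n
      & exists (hT : finGroupType) (L K R : {group hT})
               (psi : {morphism A >-> hT}) (phi : {morphism G / F >-> hT}),
          [/\ K ><| R = L, cyclic_of_order R (r ^ m)%N, isom A K psi
            & (0 < m)%N -> semiregular K R] /\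
          [/\ 'injm phi, phi @* (G / F) \subset L
            & forall (a : {perm gT}) (h : coset_of F),
                a \in A -> h \in G / F -> phi h = psi a ->
                exists g : gT, [/\ g \in G, coset F g = h
                                 & {in F, forall x, x ^ g = a x}]]].

End Cases.

(* Main.v *)
(** The power graph of [G] is a cograph iff for all commuting [b, x] in [G] of
    distinct prime orders, [b] is not a [#[b]]-th power and [<[x]>] is the only
    subgroup of prime order different from [#[b]] in [C_G(b)] (condition [tame]).
    A nilpotent group with this property that is not a p-group is cyclic of order
    [pq].  If this applies to [F = F(G)], then [G / F] embeds in
    [Aut C_p x Aut C_q], which leaves the families (2), (3) and (4).  If [F] is
    an r-group, then no [r]-element commutes with an [r']-element, so a Hall
    [r']-subgroup [X] acts semiregularly on [F].  Summing the conjugates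
    of an element of [Z(F)] over a group and over the cyclic subgroups covering it
    shows that if [x, y] in [X] have prime orders and [y] normalises [<[x]>],
    then [x] and [y] commute or generate the same subgroup.  Hence [F(G / F)]
    is cyclic or quaternion, and either [G / F] is quaternion or
    a Sylow [r]-subgroup of [G / F] acts semiregularly on [F(G / F)] as a
    complement, which is the family (5). *)

Require Import Defs.
From mathcomp Require Import all_boot all_fingroup all_solvable.
From mathcomp Require Import ssralg.

Set Implicit Arguments.
Unset Strict Implicit.
Unset Printing Implicit Defensive.

Import GroupScope.

(** * The commuting condition equivalent to being a cograph *)

(** Cyclic groups are ruled by their primary parts, so a bad path always leaves a trace among
    elements of prime order and order p^2; hence no larger orders in the condition.

    Tameness is used only through subgroups, whereas the structure wanted is that of G/F(G). When F
    is an r-group this is bridged twice: the Hall r'-subgroup X meets F trivially, so F(G/F) has a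
    copy inside the tame group X, and commuting r- and r'-elements of G/F lift to commuting elements
    of G by coprime action.

    When F is cyclic of order |x||y| with |x| < |y|, the prime |y| cannot divide |Aut <x>| = |x| -
    1. This forces C_G(y) into F; whether C_G(x) also lies in F separates families (3) and (4) from
    family (2).

    In the orbit-sum argument E = <x><y> has exactly |x| cyclic subgroups outside <x>, so Z(F) has
    exponent dividing |x|, although |F| is coprime to |E|.

    For the converse, most families come down to bounding C_G(b): if its order divides pq and it
    contains commuting b, x of distinct prime orders, it is the cyclic group <bx>. *)

Definition tame_pair (gT : finGroupType) (G : {group gT}) (b x : gT) : Prop :=
  (forall a, a \in G -> #[a] = (#[b] ^ 2)%N -> b \notin <[a]>) /\
  (forall y, y \in G -> prime #[y] -> #[y] != #[b] -> commute b y ->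
     <[y]> = <[x]>).

(** The pairs are ordered, so both clauses are also available with [b] and [x] exchanged; the
    arguments below use the two directions together. *)
Definition tame (gT : finGroupType) (G : {group gT}) : Prop :=
  forall b x : gT, b \in G -> x \in G -> prime #[b] -> prime #[x] ->
    #[b] != #[x] -> commute b x -> tame_pair G b x.

Lemma tameS (gT : finGroupType) (G H : {group gT}) :
  H \subset G -> tame G -> tame H.
Proof.
move=> /subsetP sHG tG b x Hb Hx pb px nbx cbx.
have [root uniq] := tG b x (sHG b Hb) (sHG x Hx) pb px nbx cbx.
by split=> [a /sHG | y /sHG]; [apply: root | apply: uniq].
Qed.

Lemma pow_adjE (gT : finGroupType) (x y : gT) :
  pow_adj x y <-> x <> y /\ (y \in <[x]> \/ x \in <[y]>).
Proof.
split=> -[ne cases]; split=> //; case: cases.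
- by case=> n <-; left; apply: mem_cycle.
- by case=> n <-; right; apply: mem_cycle.
- by case/cycleP=> n ->; left; exists n.
by case/cycleP=> n ->; right; exists n.
Qed.

(** An element is the product of its primary parts. This reduces non-membership of arbitrary
    elements to elements of prime power order. *)
Lemma constt_notin (gT : finGroupType) (H : {group gT}) (x : gT) :
  x \notin H -> exists p : nat, x.`_p \notin H.
Proof.
move=> nHx.
have [/existsP[p nHp] | /existsPn allH] :=
    boolP [exists p : 'I_#[x].+1, x.`_p \notin H]; first by exists p.
case/negP: nHx; rewrite -(prod_constt x) big_mkord.
by apply: group_prod => p _; have := allH p; rewrite negbK.
Qed.

Lemma mem_cycle_trans (gT : finGroupType) (x y z : gT) :
  x \in <[y]> -> y \in <[z]> -> x \in <[z]>.
Proof. by move=> yx zy; apply: (subsetP _ x yx); rewrite cycle_subG. Qed.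

Lemma cycle_eq_order (gT : finGroupType) (C x y : gT) :
  x \in <[C]> -> y \in <[C]> -> #[x] = #[y] -> <[x]> = <[y]>.
Proof.
move=> Cx Cy oxy; apply/eqP.
by rewrite (eq_subG_cyclic (cycle_cyclic C)) ?cycle_subG // -!orderE oxy.
Qed.

Lemma mem_cycle_dvd (gT : finGroupType) (C x y : gT) :
  x \in <[C]> -> y \in <[C]> -> (x \in <[y]>) = (#[x] %| #[y]).
Proof.
move=> Cx Cy; rewrite -cycle_subG.
by rewrite -(cardSg_cyclic (cycle_cyclic C)) ?cycle_subG // -!orderE.
Qed.

Lemma order_dvd_cycle (gT : finGroupType) (x y : gT) :
  x \in <[y]> -> #[x] %| #[y].
Proof. by move=> yx; rewrite [#[y]]orderE order_dvdG. Qed.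

Lemma prime_order_eq_cycle (gT : finGroupType) (x y : gT) :
  prime #[y] -> x \in <[y]> -> x != 1 -> <[x]> = <[y]>.
Proof.
move=> py yx ntx; apply: (@cycle_eq_order _ y); rewrite ?cycle_id //.
apply/eqP; have := order_dvd_cycle yx; rewrite (dvdn_prime2 _ py) //.
have /primeP[_ d] := py; have /d/orP[|/eqP->//] := order_dvd_cycle yx.
by rewrite -order_eq1 in ntx; rewrite (negPf ntx).
Qed.

(* A violation of [tame] gives the induced path [a - b - b x - x], respectively
   [b y - b - b x - x]. *)
Lemma cograph_tame (gT : finGroupType) (G : {group gT}) :
  cograph G (@pow_adj gT) -> tame G.
Proof.
move=> cog b x Gb Gx pb px nbx cbx.
have co_b (y : gT) : prime #[y] -> #[y] != #[b] -> coprime #[b] #[y].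
  by move=> py nyb; rewrite prime_coprime // dvdn_prime2 // eq_sym.
have mulb y : prime #[y] -> #[y] != #[b] -> commute b y ->
  [/\ b \in <[b * y]>, y \in <[b * y]> & #[b * y] = (#[b] * #[y])%N].
  move=> py nyb cby; rewrite cycleM ?co_b // orderM ?co_b //; split=> //.
    exact: (subsetP (mulG_subl _ _) _ (cycle_id b)).
  exact: (subsetP (mulG_subr _ _) _ (cycle_id y)).
have nd p q : prime p -> prime q -> p != q -> ~~ (p %| q).
  by move=> pp pq; rewrite dvdn_prime2.
(* The path is a - b - c - d. Only [a \notin <[c]>] and [d \notin <[a]>] have to be supplied: the
   other non-adjacencies follow by transitivity of being a power, or from the prime orders of [b]
   and [d]. *)
have P4 a c d : a \in G -> c \in G -> d \in G ->
   b \in <[a]> -> b \in <[c]> -> d \in <[c]> -> a \notin <[c]> -> d \notin <[a]>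
   -> prime #[d] -> #[d] != #[b] -> False.
  move=> Ga Gc Gd ab cb cd nca nad pd ndb; apply: cog.
  have nac : c \notin <[a]>.
    by apply: contra nad; apply: mem_cycle_trans.
  have nbd : d \notin <[b]>.
    by apply: contra nad => bd; apply: mem_cycle_trans ab.
  have ndb' : b \notin <[d]>.
    by apply/negP=> /order_dvd_cycle; rewrite (negPf (nd _ _ _ _ _)) // eq_sym.
  have nda : a \notin <[d]>.
    by apply: contra nca => da; apply: mem_cycle_trans cd.
  have ne (u v : gT) : v \notin <[u]> -> u != v.
    by apply: contraNneq => ->; rewrite cycle_id.
  exists a, b, c, d; split=> //; split.
    rewrite /= !inE !negb_or !andbT (ne a c) // (ne a d) // (ne b d) //.
    have ->: b != c by apply: contraNneq nbd => ->.
    have ->: c != d by rewrite eq_sym; apply: contraNneq ndb' => ->.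
    by have ->: a != b by apply: contraNneq nca => ->.
  split; split; try apply/pow_adjE.
  - by split; [move=> e; rewrite e cb in nca | left].
  - by split; [move=> e; rewrite e cd in nbd | right].
  - by split; [move=> e; rewrite -e cb in ndb' | left].
  - by case=> _ [] e; [rewrite e in nac | rewrite e in nca].
  - by case=> _ [] e; [rewrite e in nad | rewrite e in nda].
  by case=> _ [] e; [rewrite e in nbd | rewrite e in ndb'].
have nxb : #[x] != #[b] by rewrite eq_sym.
have [bxb bxx obx] := mulb x px nxb cbx.
split=> [a Ga oa | y Gy py nyb cby].
  apply/negP=> ab; apply: (P4 a (b * x) x) => //; first by rewrite groupM.
    apply/negP=> /order_dvd_cycle; rewrite oa obx expnS expn1.
    by rewrite dvdn_pmul2l ?prime_gt0 // (negPf (nd _ _ _ _ _)).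
  apply/negP=> /order_dvd_cycle; rewrite oa Euclid_dvdX //= andbT.
  by rewrite (negPf (nd _ _ _ _ _)).
apply/eqP/idPn=> nyx; have [byb byy oby] := mulb y py nyb cby.
have nx1: x != 1 by rewrite -order_gt1 prime_gt1.
have ny1: y != 1 by rewrite -order_gt1 prime_gt1.
have [Gby Gbx] := (groupM Gb Gy, groupM Gb Gx).
apply: (P4 (b * y) (b * x) x) => //; apply/negP.
  move=> bxby; have bxy: y \in <[b * x]>.
    exact: mem_cycle_trans byy bxby.
  case/eqP: nyx; apply: (cycle_eq_order bxy bxx).
  apply/eqP; rewrite -dvdn_prime2 //.
  by have := order_dvd_cycle bxy; rewrite obx Euclid_dvdM // (negPf (nd _ _ _ _ nyb)).
move=> byx; case/eqP: nyx; apply: (cycle_eq_order byy byx).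
apply/esym/eqP; rewrite -dvdn_prime2 //.
by have := order_dvd_cycle byx; rewrite oby Euclid_dvdM // (negPf (nd _ _ _ _ nxb)).
Qed.

Lemma p_elt_prime_order (gT : finGroupType) (p : nat) (u : gT) :
  p.-elt u -> u != 1 ->
  prime p /\ exists2 v, v \in <[u]> & #[v] = p.
Proof.
move=> pu ntu; have [|p_pr pd _] := @pgroup_pdiv _ p <[u]> pu.
  by rewrite cycle_eq1.
split=> //; have [v uv ov] := Cauchy p_pr pd; by exists v.
Qed.

(** Subgroups of a cyclic p-group form a chain, so [b] lies in the subgroup of order p^2 as soon as
    there is one; the first clause of [tame_pair] then forbids the second alternative. *)
Lemma p_elt_root (gT : finGroupType) (p : nat) (u b : gT) :
  p.-elt u -> prime p -> #[b] = p -> b \in <[u]> ->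
  <[u]> = <[b]> \/ exists a, [/\ a \in <[u]>, #[a] = (p ^ 2)%N & b \in <[a]>].
Proof.
move=> pu p_pr ob ub; have [k ok] := p_natP pu.
case: k ok => [|[|k]] ok.
- by move: (order_dvd_cycle ub); rewrite ob ok dvdn1 => /eqP p1; rewrite p1 in p_pr.
- left; apply: (@cycle_eq_order _ u); rewrite ?cycle_id //.
  by rewrite ob ok expn1.
right; exists (u ^+ (p ^ k)).
have oa: #[u ^+ (p ^ k)] = (p ^ 2)%N.
  rewrite orderXdiv ok -addn2 ?dvdn_exp2l ?leq_addr // expnD mulKn //.
  by rewrite expn_gt0 prime_gt0.
split=> //; first exact: mem_cycle.
by rewrite (@mem_cycle_dvd _ u) ?mem_cycle // oa ob dvdn_exp.
Qed.

Lemma p_elt_cycle_total (gT : finGroupType) (p : nat) (C x y : gT) :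
  x \in <[C]> -> y \in <[C]> -> p.-elt x -> p.-elt y ->
  x \in <[y]> \/ y \in <[x]>.
Proof.
move=> Cx Cy /p_natP[k ok] /p_natP[l ol].
rewrite (mem_cycle_dvd Cx Cy) (mem_cycle_dvd Cy Cx) ok ol.
by case/orP: (leq_total k l) => le; [left | right]; apply: dvdn_exp2l.
Qed.

(** In [main], choose primes p, q, r such that the p-part of b is outside <d>, the q-part of a
    outside <c> and the r-part of d outside <a>. Chains of p-subgroups in <c> give p != r, so b0 and
    d0 form a tame pair. If q = p, the q-part of a lies strictly above <b0>, against the root clause
    at b0. Otherwise uniqueness at b0 gives <a0> = <d0>, so q = r, and the r-part of d lies strictly
    above <d0>, against the root clause at d0. *)
Lemma tame_cograph (gT : finGroupType) (G : {group gT}) :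
  tame G -> cograph G (@pow_adj gT).
Proof.
move=> tG.
have main a b c d : a \in G -> b \in G -> c \in G -> d \in G ->
   b \in <[a]> -> b \in <[c]> -> d \in <[c]> -> b \notin <[d]> ->
   a \notin <[c]> -> d \notin <[a]> -> False.
  move=> Ga Gb Gc Gd ab cb cd ndb nca nad.
  have sub (u v : gT) : u \in <[v]> -> {subset <[u]> <= <[v]>}.
    by move=> uv; apply/subsetP; rewrite cycle_subG.
  have cc (z u v : gT) : u \in <[z]> -> v \in <[z]> -> commute u v.
    by case/cycleP=> i -> /cycleP[j ->]; apply: commuteX2.
  have [r nadr] := constt_notin nad.
  have [p ndbp] := constt_notin ndb.
  have [q ncaq] := constt_notin nca.
  have cdr: d.`_r \in <[c]> by rewrite (sub _ _ cd) ?cycle_constt.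
  have cbp: b.`_p \in <[c]> by rewrite (sub _ _ cb) ?cycle_constt.
  have abp: b.`_p \in <[a]> by rewrite (sub _ _ ab) ?cycle_constt.
  have nt (u z : gT) (s : nat) : u.`_s \notin <[z]> -> u.`_s != 1.
    by apply: contraNneq => ->.
  have [p_pr [b0 bb0 ob0]] := p_elt_prime_order (p_elt_constt p b) (nt _ _ _ ndbp).
  have [r_pr [d0 dd0 od0]] := p_elt_prime_order (p_elt_constt r d) (nt _ _ _ nadr).
  have [q_pr [a0 aa0 oa0]] := p_elt_prime_order (p_elt_constt q a) (nt _ _ _ ncaq).
  have npr: p != r.
    apply/eqP=> epr; have pd: p.-elt d.`_r by rewrite epr p_elt_constt.
    have [e|e] := p_elt_cycle_total cbp cdr (p_elt_constt p b) pd.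
      by rewrite (sub _ _ (cycle_constt r d) _ e) in ndbp.
    by rewrite (sub _ _ abp _ e) in nadr.
  have [ab0 cb0] := (sub _ _ abp _ bb0, sub _ _ cbp _ bb0).
  have cd0 := sub _ _ cdr _ dd0.
  have aa0' := sub _ _ (cycle_constt q a) _ aa0.
  have mG (u v : gT) : v \in G -> u \in <[v]> -> u \in G.
    by move=> Gv; apply: subsetP; rewrite cycle_subG.
  have pb0: prime #[b0] by rewrite ob0.
  have pd0: prime #[d0] by rewrite od0.
  have Gb0 := mG _ _ Ga ab0; have Gd0 := mG _ _ Gc cd0; have Ga0 := mG _ _ Ga aa0'.
  have nbd: #[b0] != #[d0] by rewrite ob0 od0.
  have cbd: commute b0 d0 by apply: (cc c).
  have [root uniq] := tG b0 d0 Gb0 Gd0 pb0 pd0 nbd cbd.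
  have [epq|npq] := eqVneq q p.
    have paq: p.-elt a.`_q by rewrite -epq p_elt_constt.
    have aqb0: b0 \in <[a.`_q]>.
      have := order_dvd_cycle aa0; rewrite oa0 epq -ob0.
      by rewrite -(@mem_cycle_dvd _ a) // cycle_constt.
    have [e|[a1 [aa1 oa1 a1b]]] := p_elt_root paq p_pr ob0 aqb0.
      by case/negP: ncaq; rewrite (sub _ _ cb0) // -e cycle_id.
    have := root a1 (mG _ _ (mG _ _ Ga (cycle_constt q a)) aa1).
    by rewrite oa1 ob0 a1b => /(_ erefl).
  have ead: <[a0]> = <[d0]>.
    apply: uniq => //; rewrite ?oa0 ?ob0 //; exact: (cc a).
  have eqr: q = r by rewrite -oa0 -od0 !orderE ead.
  have [root' _] := tG d0 b0 Gd0 Gb0 pd0 pb0 (negbT (etrans (eq_sym _ _) (negPf nbd)))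
     (commute_sym cbd).
  have [e|[d1 [dd1 od1 d1d]]] := p_elt_root (p_elt_constt r d) r_pr od0 dd0.
    case/negP: nadr; apply: (sub _ _ aa0'); rewrite ead -e; exact: cycle_id.
  have := root' d1 (mG _ _ (mG _ _ Gc cdr) dd1).
  by rewrite od1 od0 d1d => /(_ erefl).
case=> a [b [c [d [[Ga Gb Gc Gd] [_ [[ab bc cd] [nac nad nbd]]]]]]].
have non (u v : gT) : ~ pow_adj u v -> u <> v -> v \notin <[u]> /\ u \notin <[v]>.
  move=> nad' ne; split; apply/negP=> e; apply: nad'; apply/pow_adjE; split=> //.
    by left.
  by right.
have [[neab ab'] [nebc bc'] [necd cd']] :
    [/\ a <> b /\ (b \in <[a]> \/ a \in <[b]>),
        b <> c /\ (c \in <[b]> \/ b \in <[c]>)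
      & c <> d /\ (d \in <[c]> \/ c \in <[d]>)].
  by split; apply/pow_adjE.
have neac : a <> c by move=> e; apply: nad; rewrite e.
have nebd : b <> d by move=> e; apply: nad; rewrite -e.
have nead : a <> d.
  move=> e; apply: nac; rewrite e; apply/pow_adjE; split; first exact: nesym.
  by case: cd'; [right | left].
have [ac ca] := non _ _ nac neac; have [bd db] := non _ _ nbd nebd.
have [ad da] := non _ _ nad nead.
have tr (u v w : gT) := @mem_cycle_trans _ u v w.
have contra' (u v w : gT) : u \notin <[w]> -> v \in <[w]> -> u \notin <[v]>.
  by move=> nuw vw; apply: contra nuw => uv; apply: tr vw.
(* Two consecutive edges pointing the same way would compose to a chord, so the directions alternate
   along the path; the two alternating patterns are mirror images, both covered by [main]. *)
case: bc' => [cb|bc'].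
  case: ab' => [ba|ab']; first by case/negP: ac; apply: tr ba.
  case: cd' => [dc|cd']; first by case/negP: bd; apply: tr cb.
  exact: (main d c b a).
case: ab' => [ba|ab']; last by case/negP: ca; apply: tr bc'.
case: cd' => [dc|cd']; last by case/negP: db; apply: tr cd'.
exact: (main a b c d).
Qed.

(** * Centralisers and nilpotent subgroups in tame groups *)

Lemma tame_root (gT : finGroupType) (G : {group gT}) (b x v : gT) :
  tame G -> b \in G -> x \in G -> prime #[b] -> prime #[x] -> #[b] != #[x] ->
  commute b x -> v \in G -> #[b].-elt v -> b \in <[v]> -> <[v]> = <[b]>.
Proof.
move=> tG Gb Gx pb px nbx cbx Gv pv vb.
have [root _] := tG b x Gb Gx pb px nbx cbx.
have [//|[a [va oa ab]]] := p_elt_root pv pb erefl vb.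
have Ga: a \in G by apply: subsetP va; rewrite cycle_subG.
by have := root a Ga oa; rewrite ab.
Qed.

(** Any prime-order power of a primary part of [y] generates <x> by uniqueness at [b]; the root
    clause at [x], with witness [b], then prevents that primary part from being larger than <x>. *)
Lemma tame_cent_p' (gT : finGroupType) (G : {group gT}) (b x y : gT) :
  tame G -> b \in G -> x \in G -> prime #[b] -> prime #[x] -> #[b] != #[x] ->
  commute b x -> y \in G -> commute b y -> #[b]^'.-elt y -> y \in <[x]>.
Proof.
move=> tG Gb Gx pb px nbx cbx Gy cby p'y; apply/idPn=> /constt_notin[q nxq].
have yyq: y.`_q \in <[y]> by apply: cycle_constt.
have nt: y.`_q != 1 by apply: contraNneq nxq => ->; apply: group1.
have [q_pr [z yz oz]] := p_elt_prime_order (p_elt_constt q y) nt.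
have nqb: q != #[b].
  apply: contraNneq nt => eqb; apply/eqP/constt1P.
  by rewrite eqb.
have yz' := mem_cycle_trans yz yyq.
have cyc u : u \in <[y]> -> commute b u by case/cycleP=> i ->; apply: commuteX.
have sub u : u \in <[y]> -> u \in G by apply: subsetP; rewrite cycle_subG.
have [_ uniq] := tG b x Gb Gx pb px nbx cbx.
have ezx: <[z]> = <[x]> by apply: uniq; rewrite ?oz //; [apply: sub | apply: cyc].
have qx: q = #[x] by rewrite -oz !orderE ezx.
have e: <[y.`_q]> = <[x]>.
  apply: (tame_root tG Gx Gb px pb) => //; rewrite 1?eq_sym //; first exact: sub.
    by rewrite -qx p_elt_constt.
  by rewrite -cycle_subG -ezx cycle_subG.
by case/negP: nxq; rewrite /= -e cycle_id.
Qed.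

(** With [x] in O_p(N) and [y] in O_p'(N), p-parts commute with [y] and p'-parts with [x];
    [tame_cent_p'] applied at [y] and at [x] puts them into <x> and <y>. *)
Lemma tame_nilpotent (gT : finGroupType) (N : {group gT}) :
  tame N -> nilpotent N -> (forall p : nat, prime p -> ~~ p.-group N) ->
  exists x y : gT,
    [/\ prime #[x], prime #[y], #[x] != #[y] & <[x]> \x <[y]> = N].
Proof.
move=> tN nilN npN.
have ntN: N :!=: 1.
  by apply: contraNneq (npN 2 isT) => ->; apply: pgroup1.
pose p := pdiv #|N|; have p_pr: prime p by rewrite pdiv_prime // cardG_gt1.
have [x Nx ox] := Cauchy p_pr (pdiv_dvd _).
have [_ defN cpp' tipp'] := dprodP (nilpotent_pcoreC p nilN).
have /trivgPn[y0 p'y0 nty0]: 'O_p^'(N) != 1.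
  apply: contra (npN p p_pr) => /eqP p'1.
  by rewrite -defN p'1 mulg1 pcore_pgroup.
have hallp := nilpotent_pcore_Hall p nilN.
have hallp' := nilpotent_pcore_Hall p^' nilN.
have inp u : u \in N -> p.-elt u -> u \in 'O_p(N).
  by move=> Nu; rewrite -(mem_normal_Hall hallp (pcore_normal _ _) Nu).
have inp' u : u \in N -> p^'.-elt u -> u \in 'O_p^'(N).
  by move=> Nu; rewrite -(mem_normal_Hall hallp' (pcore_normal _ _) Nu).
have cc u v : u \in 'O_p(N) -> v \in 'O_p^'(N) -> commute u v.
  by move=> pu p'v; apply/esym/(centsP cpp').
pose q := pdiv #[y0].
have q_pr: prime q by rewrite pdiv_prime ?order_gt1.
have [y yy0 oy] : exists2 y, y \in <[y0]> & #[y] = q.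
  by have [|y] := @Cauchy _ q <[y0]> q_pr; [apply: pdiv_dvd | exists y].
have p'y: y \in 'O_p^'(N) by apply: subsetP yy0; rewrite cycle_subG.
have Ny: y \in N by apply: subsetP p'y; apply: pcore_sub.
have px: x \in 'O_p(N) by apply: inp => //; rewrite /p_elt ox pnat_id.
have nxy: #[x] != #[y].
  rewrite ox oy; apply: contraTneq (mem_p_elt (pcore_pgroup _ _) p'y) => e.
  by rewrite /p_elt oy -e pnatE // inE /= inE eqxx.
have cxy := cc x y px p'y.
have pox : prime #[x] by rewrite ox.
have poy : prime #[y] by rewrite oy.
exists x, y; split=> //.
have sxyN: <[x]> * <[y]> \subset N by rewrite mul_subG ?cycle_subG.
rewrite dprodE ?cent_cycle ?cycle_subG //; first last.
- by apply: coprime_TIg; rewrite -!orderE prime_coprime // dvdn_prime2.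
- by apply/cent1P.
apply/eqP; rewrite eqEsubset sxyN; apply/subsetP=> n Nn.
rewrite -(consttC p n); apply: mem_mulg.
  have Nnp : n.`_p \in N by apply: groupX.
  apply: (@tame_cent_p' _ N y) => //; rewrite 1?eq_sym //.
    by apply/commute_sym/cc => //; apply: inp; rewrite ?p_elt_constt.
  by rewrite /p_elt (pi_pnat (p_elt_constt p n)) // inE /= inE -ox.
have Nnp : n.`_p^' \in N by apply: groupX.
apply: (@tame_cent_p' _ N x) => //; last by rewrite ox p_elt_constt.
by apply/cc => //; apply: inp'; rewrite ?p_elt_constt.
Qed.

(** * Semiregular actions of groups generated by two elements of prime order *)

Section OrbitSums.
Import FiniteModule GRing.Theory.
Local Open Scope ring_scope.

(** Right translation by an element of [A] permutes the summands, so the sum is a fixed point.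
    [fmod_of] supplies the additive notation for the abelian group [V]. *)
Lemma orbit_sum_eq0 (gT : finGroupType) (V A : {group gT}) (abV : abelian V)
    (u : fmod_of abV) :
  A \subset 'N(V) -> 'C_V(A) = 1%g -> \sum_(a in A) u ^@ a = 0.
Proof.
move=> nVA cVA; set w := \sum_(a in A) _.
suffices: val w \in 'C_V(A) by rewrite cVA => /set1P w1; apply: val_inj.
rewrite inE fmodP /=; apply/centP => b Ab.
apply/commgP/conjg_fixP; rewrite -fmvalJ ?(subsetP nVA) //; congr (val _).
rewrite /w actr_sum [RHS](reindex_inj (mulIg b)) /=.
apply: eq_big => [a|a Aa]; first by rewrite groupMr.
by rewrite actrM ?(subsetP nVA).
Qed.

(* Sum the conjugates of an element of [V] over [E], over [K], and over the cyclic
   subgroups of [E] not contained in [K]: each of these sums is fixed by the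
   corresponding group, hence zero. *)
Lemma semiregular_prime_cover (gT : finGroupType) (V E K : {group gT}) (u : nat) :
  abelian V -> E \subset 'N(V) -> semiregular V E -> K \subset E -> K :!=: 1%g ->
  prime u -> {in E :\: K, forall e, #[e] = u} ->
  {in V, forall v, v ^+ (#|E :\: K| %/ u.-1) = 1}%g.
Proof.
move=> abV nVE regE sKE ntK u_pr oE v Vv.
have sum0 (A : {group gT}) : A \subset E -> A :!=: 1%g ->
  \sum_(a in A) (fmod abV v) ^@ a = 0.
  move=> sAE ntA; apply: orbit_sum_eq0; first exact: subset_trans nVE.
  exact: cent_semiregular regE sAE ntA.
have ntE: E :!=: 1%g by apply: subG1_contra ntK.
(* As e has prime order, the elements outside K that generate <e> are exactly the u - 1 nontrivial
   elements of <e>; hence E :\: K splits into blocks of size u - 1. *)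
have fiber e : e \in E :\: K ->
  [pred x | (x \in E :\: K) && (<[x]>%g == <[e]>%g)] =i <[e]>^#%g.
  move=> De x; rewrite !inE /=; have oe := oE e De.
  move: De; rewrite !inE => /andP[nKe Ee].
  apply/andP/andP => [[/andP[nKx Ex] /eqP <-]|[ntx ex]].
    by rewrite cycle_id; split=> //; apply: contraNneq nKx => ->.
  have exe: <[x]>%g = <[e]>%g by apply: prime_order_eq_cycle; rewrite ?oe.
  rewrite exe eqxx; split=> //; apply/andP; split.
    by apply: contra nKe => Kx; rewrite -cycle_subG -exe cycle_subG.
  by apply: subsetP ex; rewrite cycle_subG.
set P := (@cycle gT) @: (E :\: K).
have cardP: #|E :\: K| = (#|P| * u.-1)%N.
  rewrite -sum1_card (partition_big_imset (@cycle gT)) -/P /=.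
  rewrite -sum_nat_const; apply: eq_bigr => _ /imsetP[e De ->].
  rewrite sum1dep_card -(oE e De) [#[e]]orderE (cardsD1 1%g <[e]>%g) (group1 <[e]>%G).
  by rewrite add1n /= -(eq_card (fiber e De)); apply: eq_card => x; rewrite !inE.
rewrite cardP mulnK; last by rewrite -subn1 subn_gt0 prime_gt1.
(* The sums over E and over K vanish, so the sum over E :\: K does. A block contributes the zero sum
   over <e> minus the term of the identity, that is -v, so v times the number of blocks is 0. *)
have: \sum_(a in E) (fmod abV v) ^@ a = 0 by apply: sum0.
rewrite (big_setID K) /= (setIidPr sKE) sum0 // add0r.
rewrite (partition_big_imset (@cycle gT)) -/P /=.
rewrite (eq_bigr (fun _ => - fmod abV v)); last first.
  move=> _ /imsetP[e De ->].
  rewrite (eq_bigl _ _ (fiber e De)).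
  have Ee: <[e]>%g \subset E by move: De; rewrite cycle_subG !inE => /andP[].
  have := sum0 _ Ee; rewrite (big_setD1 1%g) ?group1 //= actr1.
  move=> /(_ _)/eqP; rewrite addrC addr_eq0 => /(_ _)/eqP; apply.
  by rewrite cycle_eq1 -order_gt1 oE ?prime_gt1.
rewrite sumr_const mulNrn => /eqP; rewrite oppr_eq0 => /eqP e0.
by rewrite -(fmodK abV Vv) -fmvalZ e0.
Qed.

End OrbitSums.

Lemma dvdn_prime_mul (d s u : nat) : prime s -> prime u -> d %| s * u ->
  [\/ d = 1, d = s, d = u | d = s * u]%N.
Proof.
move=> s_pr u_pr dsu; have prime_div q k : prime q -> k %| q -> k = 1%N \/ k = q.
  by move=> /primeP[_ dq] /dq /orP[]/eqP; [left | right].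
have [/dvdnP[k e]|nsd] := boolP (s %| d).
  move: dsu; rewrite e mulnC dvdn_pmul2l ?prime_gt0 // => /(prime_div _ _ u_pr)[] ->.
    by rewrite muln1; constructor 2.
  by constructor 4.
have: d %| u by rewrite -(@Gauss_dvdr d s) // coprime_sym prime_coprime.
by case/(prime_div _ _ u_pr) => ->; [constructor 1 | constructor 3].
Qed.

(** If E = <x><y> is cyclic both claims are immediate. Otherwise every element of E outside <x> has
    order |y|, and the covering argument with K = <x> kills Z(F), which is impossible for a
    nontrivial nilpotent F. *)
Lemma semiregular_prime_pair (gT : finGroupType) (F : {group gT}) (x y : gT) :
  nilpotent F -> F :!=: 1 -> <[x]> <*> <[y]> \subset 'N(F) ->
  semiregular F (<[x]> <*> <[y]>) -> y \in 'N(<[x]>) ->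
  prime #[x] -> prime #[y] ->
  (#[x] != #[y] -> commute x y) /\ (#[x] = #[y] -> <[x]> = <[y]>).
Proof.
move=> nilF ntF; set E := <[x]> <*> <[y]> => nFE regE nxy px py.
have [xy|nxy'] := boolP (y \in <[x]>).
  have nty: y != 1 by rewrite -order_gt1 prime_gt1.
  split=> [|_]; last by rewrite (prime_order_eq_cycle px xy nty).
  by case/cycleP: xy => i -> _; apply: commuteX.
have tixy : <[x]> :&: <[y]> = 1.
  by rewrite setIC prime_TIg -?orderE // cycle_subG.
have defE : <[x]> * <[y]> = E by rewrite /E norm_joinEr // cycle_subG.
have oE : #|E| = (#[x] * #[y])%N by rewrite -defE TI_cardMg.
have sxE : <[x]> \subset E by apply: joing_subl.
have syE : <[y]> \subset E by apply: joing_subr.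
have [cycE|ncycE] := boolP (cyclic E).
  split=> [_|exy].
    by apply: (centsP (cyclic_abelian cycE)); rewrite -cycle_subG.
  by apply/eqP; rewrite (eq_subG_cyclic cycE) // -!orderE exy.
have ZF : 'Z(F) = 1.
  have nZE : E \subset 'N('Z(F)) := char_norm_trans (center_char F) nFE.
  have regZ : semiregular 'Z(F) E by apply: semiregularS regE => //; apply: center_sub.
  have oDE e : e \in E :\: <[x]> -> #[e] = #[y].
    case/setDP=> Ee nxe.
    have := order_dvdG Ee; rewrite oE.
    case/(dvdn_prime_mul px py) => [e1|ex|//|exy].
    - by move/eqP: e1; rewrite order_eq1 => /eqP e1; rewrite e1 group1 in nxe.
    - have [exy|nexy] := eqVneq #[x] #[y]; first by rewrite ex.
      have nsx : <[x]> <| E.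
        by rewrite /normal sxE join_subG normG cycle_subG.
      have hallx : #[x].-Hall(E) <[x]>.
        rewrite pHallE sxE -orderE oE partnM ?prime_gt0 //= part_pnat_id ?pnat_id //.
        by rewrite part_p'nat ?muln1 // pnatE // inE /= inE eq_sym.
      by case/negP: nxe; rewrite (mem_normal_Hall hallx nsx Ee) /p_elt ex pnat_id.
    case/negP: ncycE; suffices defe : <[e]> = E by rewrite -defe cycle_cyclic.
    by apply/eqP; rewrite eqEcard cycle_subG Ee -orderE oE exy leqnn.
  have ntx : <[x]>%G :!=: 1 by rewrite cycle_eq1 -order_gt1 prime_gt1.
  have := semiregular_prime_cover (center_abelian F) nZE regZ sxE ntx py oDE.
  (* |E| - |<x>| = |x|(|y| - 1), so there are |x| blocks; since semiregularity makes |F| coprime to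
     |E|, the relation v^|x| = 1 leaves only v = 1. *)
  have -> : (#|E :\: <[x]>| %/ #[y].-1 = #[x])%N.
    rewrite cardsD (setIidPr sxE) oE -orderE -{2}[#[x]]muln1 -mulnBr subn1 mulnK //.
    by rewrite -subn1 subn_gt0 prime_gt1.
  move=> expZ; apply/trivgP/subsetP=> v Zv; rewrite inE -order_eq1 -dvdn1.
  have co : coprime #|F| #|E| := regular_norm_coprime nFE regE.
  have cov : coprime #[v] #[x].
    apply: coprime_dvdl (order_dvdG (subsetP (center_sub F) v Zv)) _.
    by apply: coprime_dvdr co; rewrite oE dvdn_mulr.
  by rewrite -(eqnP cov) dvdn_gcd dvdnn order_dvdn expZ ?eqxx.
by case/eqP: ntF; apply: (TI_center_nil nilF (normal_refl F)); rewrite ZF setIg1.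
Qed.

(** * Fitting subgroups that are not of prime power order *)

Lemma nilpotent_central_quotient (gT : finGroupType) (G H : {group gT}) :
  H \subset 'Z(G) -> nilpotent (G / H) -> nilpotent G.
Proof.
move=> sHZ nilGH; rewrite -quotient_center_nil.
have /andP[_ nHG]: H <| G := sub_center_normal sHZ.
have [f <-]:= homgP (homg_quotientS nHG (gFnorm _ G) sHZ).
exact: morphim_nil nilGH.
Qed.

(** Put C = C_G(F) and Z = C :&: F. The preimage M of F(C/Z) has Z in its centre, so it is nilpotent
    and normal in G; hence M lies in F, thus in Z. So F(C/Z) = 1, and solvability forces C = Z. *)
Lemma solvable_cent_Fitting (gT : finGroupType) (G : {group gT}) :
  solvable G -> 'C_G('F(G)) \subset 'F(G).
Proof.
move=> solG; set F := 'F(G)%G; set C := 'C_G(F)%G; set Z := (C :&: F)%G.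
have nsFG : F <| G := Fitting_normal G.
have nsCG : C <| G.
  by rewrite /normal subsetIl normsI ?normG // norms_cent ?normal_norm.
have nsZG : Z <| G by apply: normalI.
have nsCZ : C / Z <| G / Z by apply: quotient_normal.
have nsFC : 'F(C / Z) <| G / Z by apply: char_normal_trans (Fitting_char _) nsCZ.
have [M defM sZM nsMG] := inv_quotientN nsZG nsFC.
have nsZC : Z <| C by apply: normalS (subsetIl _ _) (normal_sub nsCG) nsZG.
have nZM : M \subset 'N(Z) := subset_trans (normal_sub nsMG) (normal_norm nsZG).
have sMC : M \subset C.
  by rewrite -(quotientSGK nZM (normal_sub nsZC)) -defM Fitting_sub.
have cMZ : Z \subset 'Z(M).
  rewrite subsetI sZM centsC; apply: subset_trans sMC _.
  exact: subset_trans (subsetIr G 'C(F)) (centS (subsetIr C F)).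
have nilM : nilpotent M.
  by apply: nilpotent_central_quotient cMZ _; rewrite /= -defM Fitting_nil.
have sMZ : M \subset Z by rewrite subsetI sMC Fitting_max.
have : 'F(C / Z) == 1 by rewrite defM -subG1 quotient_sub1.
rewrite trivg_Fitting ?quotient_sol ?(solvableS (normal_sub nsCG)) //.
rewrite -subG1 quotient_sub1 ?(normal_norm nsZC) //.
by move=> sCZ; apply: subset_trans sCZ (subsetIr _ _).
Qed.

Lemma coprime_Aut_cent (gT : finGroupType) (A : {group gT}) (g : gT) :
  g \in 'N(A) -> coprime #[g] #|Aut A| -> g \in 'C(A).
Proof.
move=> nAg co; rewrite -ker_conj_aut; apply/kerP => //.
apply/eqP; rewrite -order_eq1 -dvdn1 -(eqnP co) dvdn_gcd morph_order //=.
apply: order_dvdG; apply: (subsetP (Aut_conj_aut A <[g]>)).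
by rewrite mem_morphim ?cycle_id.
Qed.

Lemma der1_cent_cyclic (gT : finGroupType) (G A : {group gT}) :
  cyclic A -> G \subset 'N(A) -> G^`(1) \subset 'C(A).
Proof.
move=> cycA nAG; have sG'G : G^`(1) \subset G := der_sub 1 G.
apply/subsetP=> g G'g; rewrite -ker_conj_aut.
apply/kerP; first by rewrite (subsetP nAG) ?(subsetP sG'G).
have : conj_aut A g \in conj_aut A @* G^`(1).
  by rewrite mem_morphim // (subsetP nAG) ?(subsetP sG'G).
rewrite morphim_der //; have -> : (conj_aut A @* G)^`(1) = 1.
  apply/derG1P; apply: abelianS (Aut_cyclic_abelian cycA); exact: Aut_conj_aut.
by move/set1P.
Qed.

Lemma dprod_cycle_mem (gT : finGroupType) (F : {group gT}) (x y : gT) :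
  <[x]> \x <[y]> = F -> [/\ x \in F, y \in F & commute x y].
Proof.
case/dprodP=> _ defF cxy _; rewrite -defF; split.
- exact: (subsetP (mulG_subl _ _) _ (cycle_id x)).
- exact: (subsetP (mulG_subr _ _) _ (cycle_id y)).
by apply/esym/(centsP cxy); apply: cycle_id.
Qed.

Lemma dprod_prime_cycles (gT : finGroupType) (F : {group gT}) (x y : gT) :
  prime #[x] -> prime #[y] -> #[x] != #[y] -> <[x]> \x <[y]> = F ->
  cyclic F /\ #|F| = (#[x] * #[y])%N.
Proof.
move=> px py nxy defF; rewrite (dprod_card defF); split=> //.
rewrite (cyclic_dprod defF) ?cycle_cyclic // -!orderE.
by rewrite prime_coprime // dvdn_prime2.
Qed.

Lemma mem_prime_order_cyclic (gT : finGroupType) (F : {group gT}) (x y z : gT) :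
  prime #[x] -> prime #[y] -> #[x] != #[y] -> <[x]> \x <[y]> = F ->
  z \in F -> z != 1 -> x \in <[z]> \/ y \in <[z]>.
Proof.
move=> px py nxy defF Fz ntz.
have [cycF oF] := dprod_prime_cycles px py nxy defF.
have [Fx Fy _] := dprod_cycle_mem defF.
have sub u : u \in F -> (u \in <[z]>) = (#[u] %| #[z]).
  by move=> Fu; rewrite -cycle_subG -(cardSg_cyclic cycF) ?cycle_subG.
have := order_dvdG Fz; rewrite oF => /(dvdn_prime_mul px py)[] oz.
- by move/eqP: oz; rewrite order_eq1 (negPf ntz).
- by left; rewrite sub // oz.
- by right; rewrite sub // oz.
by left; rewrite sub // oz dvdn_mulr.
Qed.

Lemma Fitting_prime_cycles_normal (gT : finGroupType) (G : {group gT}) (x y : gT) :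
  prime #[x] -> prime #[y] -> #[x] != #[y] -> <[x]> \x <[y]> = 'F(G) ->
  <[x]> <| G /\ <[y]> <| G.
Proof.
move=> px py nxy defF; have [Fx Fy _] := dprod_cycle_mem defF.
have [cycF _] := dprod_prime_cycles px py nxy defF.
have nF u : u \in 'F(G) -> <[u]> <| G.
  move=> Fu; apply: char_normal_trans (Fitting_normal G).
  by rewrite sub_cyclic_char // cycle_subG.
by rewrite !nF.
Qed.

(** The |y|-part of an element centralising [y] acts on <x> with order coprime to |x| - 1, so it
    centralises F and lies in F. The remaining part lies in <x> by [tame_cent_p']. *)
Lemma cent_larger_prime (gT : finGroupType) (G : {group gT}) (x y : gT) :
  solvable G -> tame G -> prime #[x] -> prime #[y] -> #[x] < #[y] ->
  <[x]> \x <[y]> = 'F(G) -> 'C_G[y] \subset 'F(G).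
Proof.
move=> solG tG px py ltxy defF; have [Fx Fy cxy] := dprod_cycle_mem defF.
have nxy: #[x] != #[y] by rewrite neq_ltn ltxy.
have [nsx nsy] := Fitting_prime_cycles_normal px py nxy defF.
have sFG := Fitting_sub G; have [Gx Gy] := (subsetP sFG x Fx, subsetP sFG y Fy).
apply/subsetP=> e /setIP[Ge /cent1P cye]; rewrite -(consttC #[y] e) groupM //.
  have cye' : commute e.`_(#[y]) y by apply/commute_sym/commuteX.
  apply: (subsetP (solvable_cent_Fitting solG)); rewrite inE groupX //=.
  have Cy : e.`_(#[y]) \in 'C(<[y]>) by rewrite cent_cycle; apply/cent1P.
  have [_ <- _ _] := dprodP defF; rewrite centM inE Cy andbT.
  rewrite coprime_Aut_cent ?(subsetP (normal_norm nsx)) ?groupX //=.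
  rewrite card_Aut_cyclic ?cycle_cyclic // -orderE totient_prime //.
  rewrite order_constt p_part coprimeXl // prime_coprime // gtnNdvd //.
    by rewrite -subn1 subn_gt0 prime_gt1.
  by rewrite prednK ?prime_gt0 // ltnW.
have Gep : e.`_(#[y])^' \in G by rewrite groupX.
have xe : e.`_(#[y])^' \in <[x]>.
  apply: (tame_cent_p' tG Gy Gx py px) => //; rewrite 1?eq_sym ?p_elt_constt //.
  by apply/commuteX.
by apply: subsetP xe; rewrite cycle_subG.
Qed.

(** Every nontrivial element of F has [x] or [y] among its powers, so whatever centralises it
    centralises [x] or [y] and lies in F. *)
Lemma semiregular_Fitting_cycles (gT : finGroupType) (G W : {group gT}) (x y : gT) :
  prime #[x] -> prime #[y] -> #[x] != #[y] -> <[x]> \x <[y]> = 'F(G) ->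
  'C_G[x] \subset 'F(G) -> 'C_G[y] \subset 'F(G) ->
  W \subset G -> 'F(G) :&: W = 1 -> semiregular 'F(G) W.
Proof.
move=> px py nxy defF sCx sCy sWG tiFW w /setD1P[ntw Ww].
apply/trivgP/subsetP=> z /setIP[Fz /cent1P cwz]; rewrite inE.
apply: contraR ntw => ntz; rewrite -in_set1 -[[set 1]]tiFW inE Ww andbT.
have cw u : u \in <[z]> -> w \in 'C_G[u].
  rewrite inE (subsetP sWG) //= => /cycleP[i ->]; apply/cent1P.
  by apply: commuteX.
have [] := mem_prime_order_cyclic px py nxy defF Fz ntz => /cw Cw.
  exact: (subsetP sCx).
exact: (subsetP sCy).
Qed.

Lemma pgroup_or_not (gT : finGroupType) (W : {group gT}) :
  (exists2 r : nat, prime r & r.-group W) \/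
  (forall r : nat, prime r -> ~~ r.-group W).
Proof.
have [->|ntW] := eqVneq (W : {set gT}) 1; first by left; exists 2; rewrite ?pgroup1.
have pr : prime (pdiv #|W|) by rewrite pdiv_prime ?cardG_gt1.
have [rW|nrW] := boolP ((pdiv #|W|).-group W); first by left; exists (pdiv #|W|).
right=> p p_pr; apply: contra nrW => pW.
by have /(pgroupP pW) := pdiv_dvd #|W| => /(_ pr); rewrite inE => /eqP->.
Qed.

Lemma cyclic_quotient_cent_prime (gT : finGroupType) (A W : {group gT}) :
  prime #|A| -> W \subset 'N(A) -> cyclic (W / 'C_W(A)).
Proof.
move=> pA nAW; have := first_isog_loc (conj_aut A) nAW.
rewrite /= ker_conj_aut => /isog_cyclic->.
exact: cyclicS (Aut_conj_aut A W) (Aut_prime_cyclic pA).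
Qed.

Lemma cyclic_faithful_prime (gT : finGroupType) (A W : {group gT}) :
  prime #|A| -> W \subset 'N(A) -> 'C_W(A) = 1 -> cyclic W.
Proof.
move=> pA nAW cWA; have := cyclic_quotient_cent_prime pA nAW.
by rewrite cWA -(isog_cyclic (quotient1_isog W)).
Qed.

(** Since C_G(x) lies in F, |G : F| divides |x| - 1, which is coprime to |x||y|. Hence F has a
    complement W, semiregular on F and cyclic as a subgroup of Aut <x>; being tame, W is a p-group
    or a product of two cycles of prime order. *)
Lemma Fitting_pq_Frobenius (gT : finGroupType) (G : {group gT}) (x y : gT) :
  solvable G -> tame G -> prime #[x] -> prime #[y] -> #[x] < #[y] ->
  <[x]> \x <[y]> = 'F(G) -> 'C_G[x] \subset 'F(G) ->
  (exists p q r n : nat,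
     distinct_primes [:: p; q; r] /\ case_pq_by_r G p q r n) \/
  (exists p q r s : nat,
     distinct_primes [:: p; q; r; s] /\ case_rs_by_pq G p q r s).
Proof.
move=> solG tG px py ltxy defF sCx.
have sCy := cent_larger_prime solG tG px py ltxy defF.
have [Fx Fy cxy] := dprod_cycle_mem defF.
have nxy: #[x] != #[y] by rewrite neq_ltn ltxy.
have [nsx nsy] := Fitting_prime_cycles_normal px py nxy defF.
have [cycF oF] := dprod_prime_cycles px py nxy defF.
have nsF := Fitting_normal G.
have idxF : #|G : 'F(G)| %| #[x].-1.
  have := cardSg (Aut_conj_aut <[x]> G).
  rewrite card_Aut_cyclic ?cycle_cyclic // -orderE totient_prime //.
  rewrite card_morphim (setIidPr (normal_norm nsx)) /= ker_conj_aut cent_cycle.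
  by rewrite -indexgI; apply: dvdn_trans; apply: indexgS.
have hallF : Hall G 'F(G).
  rewrite /Hall Fitting_sub /= oF; apply: coprime_dvdr idxF _.
  rewrite coprimeMl coprimenP ?prime_gt0 // prime_coprime // gtnNdvd //.
    by rewrite -subn1 subn_gt0 prime_gt1.
  by rewrite prednK ?prime_gt0 // ltnW.
have /splitsP[W /complP[tiFW defG]] := SchurZassenhaus_split hallF nsF.
have sWG : W \subset G by rewrite -defG mulG_subr.
have nFW : W \subset 'N('F(G)) := subset_trans sWG (normal_norm nsF).
have sdG : 'F(G) ><| W = G by rewrite sdprodE.
have regW := semiregular_Fitting_cycles px py nxy defF sCx sCy sWG tiFW.
have coFW := regular_norm_coprime nFW regW.
have regx u : u \in 'F(G) -> <[u]> <| G -> #|W| %| #[u].-1.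
  move=> Fu nsu; apply: regular_norm_dvd_pred.
    exact: subset_trans sWG (normal_norm nsu).
  by apply: semiregularS regW; rewrite ?cycle_subG.
have dWx := regx x Fx nsx; have dWy := regx y Fy nsy.
have nF u : prime u -> u %| #|W| -> u != #[x] /\ u != #[y].
  move=> pu uW; move: coFW; rewrite oF coprimeMl => /andP[cox coy].
  split; [move: cox | move: coy]; rewrite coprime_sym;
  move/(coprime_dvdl uW); rewrite prime_coprime // dvdn_prime2 // eq_sym //.
have cycW : cyclic W.
  apply: cyclic_faithful_prime (_ : prime #|<[x]>|) _ _; rewrite -?orderE //.
    exact: subset_trans sWG (normal_norm nsx).
  apply/trivgP; rewrite -tiFW /= cent_cycle subsetI subsetIl andbT.
  by apply: subset_trans sCx; rewrite setSI.
have [[r pr rW]|npW] := pgroup_or_not W.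
  left; have [n oW] := p_natP rW.
  (* For W = 1 the prime r is arbitrary and might equal |x| or |y|, so it is replaced by a prime
     above |y|, with n = 0. *)
  have [r' [pr' [nr'x nr'y] oW']] :
      exists r', [/\ prime r', r' != #[x] /\ r' != #[y] & #|W| = (r' ^ n)%N].
    case: n oW => [|n] oW; last first.
      by exists r; split=> //; apply: nF => //; rewrite oW dvdn_exp.
    have [r' ltr' pr'] := prime_above #[y].
    exists r'; split=> //; split; rewrite neq_ltn ?ltr' ?orbT //.
    by rewrite (ltn_trans ltxy) ?orbT.
  exists #[x], #[y], r', n; split.
    by rewrite /distinct_primes /= px py pr' !inE negb_or nxy !(eq_sym _ r') nr'x nr'y.
  exists 'F(G)%G, W; rewrite /cyclic_of_order cycF cycW oF oW' !eqxx; split=> //.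
right; have [u [v [pu pv nuv defW]]] := tame_nilpotent (tameS sWG tG)
  (abelian_nil (cyclic_abelian cycW)) npW.
have [_ oW] := dprod_prime_cycles pu pv nuv defW.
have [nux nuy] : #[u] != #[x] /\ #[u] != #[y] by apply: nF; rewrite // oW dvdn_mulr.
have [nvx nvy] : #[v] != #[x] /\ #[v] != #[y] by apply: nF; rewrite // oW dvdn_mull.
exists #[u], #[v], #[x], #[y]; split.
  rewrite /distinct_primes /= px py pu pv !inE !negb_or.
  by rewrite nuv nux nuy nvx nvy nxy.
rewrite /case_rs_by_pq -oW !subn1; split=> //; exists 'F(G)%G, W.
by rewrite /cyclic_of_order cycF cycW oF !eqxx.
Qed.

(** By [tame_cent_p'] at [y], C_U(y) = <x>, so U/<x> embeds in the cyclic group Aut <y>; as <x> is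
    central, U is abelian. A lift [v] of a generator of U/<x> cannot have [x] as a power, by the
    root clause at [x]. *)
Lemma Fitting_pq_Sylow_split (gT : finGroupType) (G U : {group gT}) (x y : gT) :
  tame G -> prime #[x] -> prime #[y] -> #[x] != #[y] ->
  x \in G -> y \in G -> commute x y -> <[y]> <| G ->
  U \subset 'C_G[x] -> #[x].-group U -> x \in U -> ~~ (U \subset <[x]>) ->
  exists2 v, v != 1 & <[x]> \x <[v]> = U.
Proof.
move=> tG px py nxy Gx Gy cxy nsy sUC xU Ux nUx.
have sUG : U \subset G := subset_trans sUC (subsetIl _ _).
have nyU : U \subset 'N(<[y]>) := subset_trans sUG (normal_norm nsy).
have cUy : 'C_U(<[y]>) = <[x]>.
  have Cyx : x \in 'C(<[y]>) by rewrite cent_cycle; apply/cent1P.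
  apply/eqP; rewrite eqEsubset cycle_subG in_setI Ux Cyx /= andbT.
  apply/subsetP=> u /setIP[Uu]; rewrite cent_cycle => /cent1P cyu.
  apply: (tame_cent_p' tG Gy Gx) => //.
  - by rewrite eq_sym.
  - exact: (subsetP sUG).
  by rewrite /p_elt (pi_pnat (mem_p_elt xU Uu)) // inE /= inE.
have sxZ : <[x]> \subset 'Z(U).
  by rewrite cycle_subG inE Ux -sub_cent1 (subset_trans sUC) ?subsetIr.
have cycUx : cyclic (U / <[x]>).
  by rewrite -cUy; apply: cyclic_quotient_cent_prime; rewrite -?orderE.
have abU := cyclic_factor_abelian sxZ cycUx.
have nxU : U \subset 'N(<[x]>).
  by rewrite cents_norm // centsC (subset_trans sxZ) ?subsetIr.
have [vb defvb] := cyclicP cycUx.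
have Uvb : vb \in U / <[x]> by rewrite defvb cycle_id.
have [v nv Uv evb] := morphimP Uvb; rewrite evb in defvb.
have sxU : <[x]> \subset U by rewrite cycle_subG.
have defU : <[x]> * <[v]> = U.
  rewrite -norm_joinEr ?cycle_subG // -quotientYK ?cycle_subG //.
  by rewrite quotient_cycle // -defvb quotientGK // /normal sxU.
have nxv : x \notin <[v]>.
  apply: contra nUx => vx; rewrite -defU.
  have -> : <[v]> = <[x]>.
    apply: (tame_root tG Gx Gy) => //; first exact: (subsetP sUG).
    exact: mem_p_elt xU Uv.
  by rewrite mulGid.
exists v.
  by apply: contraNneq nUx => v1; rewrite -defU v1 cycle1 mulg1.
rewrite dprodE //.
  by apply: (sub_abelian_cent2 abU); rewrite ?cycle_subG.
by rewrite prime_TIg -?orderE // cycle_subG.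
Qed.

(* Let [U] be a Sylow [p]-subgroup of [C_G(x)], with [p = #[x]].  Were [C_G(x)]
   smaller than [G], an element [g] of prime order of [N_G(U)] outside [C_G(x)]
   would centralise some [c] of order [p] in [U], and then the order-[#[g]]
   subgroups [<[g]>] and [<[g ^ x]>] would be distinct in [C_G(c)]. *)
Lemma Fitting_pq_central (gT : finGroupType) (G : {group gT}) (x y : gT) :
  solvable G -> tame G -> prime #[x] -> prime #[y] -> #[x] < #[y] ->
  <[x]> \x <[y]> = 'F(G) -> ~~ ('C_G[x] \subset 'F(G)) -> G \subset 'C[x].
Proof.
move=> solG tG px py ltxy defF nCxF.
have sCy := cent_larger_prime solG tG px py ltxy defF.
have [Fx Fy cxy] := dprod_cycle_mem defF.
have nxy: #[x] != #[y] by rewrite neq_ltn ltxy.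
have [nsx nsy] := Fitting_prime_cycles_normal px py nxy defF.
have sFG := Fitting_sub G; have [Gx Gy] := (subsetP sFG x Fx, subsetP sFG y Fy).
set D := 'C_G[x]%G.
have nsDG : D <| G.
  rewrite /normal subsetIl normsI ?normG //= -cent_cycle.
  exact/norms_cent/normal_norm.
have Dp' d : d \in D -> #[x]^'.-elt d -> d \in <[y]>.
  by case/setIP=> Gd /cent1P cxd; apply: (tame_cent_p' tG Gx Gy px py).
(* A prime s >= |x| does not divide |Aut <x>| = |x| - 1. Consequently the prime s chosen below is
   smaller than |x|. *)
have Dsmall (s : nat) g : g \in G -> s.-elt g -> prime s -> #[x] <= s -> g \in D.
  move=> Gg sg s_pr le_xs; rewrite inE Gg /= -cent_cycle.
  apply: coprime_Aut_cent; first exact: (subsetP (normal_norm nsx)).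
  rewrite card_Aut_cyclic ?cycle_cyclic // -orderE totient_prime //.
  apply: pnat_coprime sg _; rewrite p'natE // gtnNdvd //.
    by rewrite -subn1 subn_gt0 prime_gt1.
  by rewrite prednK ?prime_gt0.
have /subsetPn[d Dd nFd] := nCxF.
have Ddx : d.`_(#[x]) \in D by rewrite groupX.
have nFdx : d.`_(#[x]) \notin 'F(G).
  apply: contra nFd => Fdx; rewrite -(consttC #[x] d) groupM //.
  have : d.`_(#[x])^' \in <[y]> by apply: Dp'; rewrite ?groupX ?p_elt_constt.
  by apply: subsetP; rewrite cycle_subG.
have sdxD : <[d.`_(#[x])]> \subset D by rewrite cycle_subG.
have [U sylU dU] := Sylow_superset sdxD (p_elt_constt #[x] d).
have pU := pHall_pgroup sylU; have sUD := pHall_sub sylU.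
have Udx : d.`_(#[x]) \in U by rewrite -cycle_subG.
have nUx : ~~ (U \subset <[x]>).
  apply/subsetPn; exists d.`_(#[x]) => //; apply: contra nFdx.
  by apply: subsetP; rewrite cycle_subG.
have Dx : x \in D by rewrite inE Gx cent1id.
have Ux : x \in U.
  rewrite -cycle_subG (normal_sub_max_pgroup (Hall_max sylU)) //.
    by rewrite /pgroup -orderE pnat_id.
  by apply: normalS nsx; rewrite ?subsetIl // cycle_subG.
have [v ntv defU] := Fitting_pq_Sylow_split tG px py nxy Gx Gy cxy nsy sUD pU Ux nUx.
have abU : abelian U.
  by have [_ <- cxv _] := dprodP defU; rewrite abelianM !cycle_abelian.
apply/idPn=> nGx.
(* The Frattini argument gives G = D N_G(U), so N_G(U) inside D would make [x] central. *)
have /subsetPn[n NUn nDn] : ~~ ('N_G(U) \subset D).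
  apply: contra nGx => sND; rewrite -(Frattini_arg nsDG sylU).
  by rewrite mul_subG ?subsetIr // (subset_trans sND) ?subsetIr.
have [s nDns] := constt_notin nDn.
set g1 := n.`_s in nDns.
have ntg1 : g1 != 1 by apply: contraNneq nDns => ->.
have [s_pr [g gg1 og]] := p_elt_prime_order (p_elt_constt s n) ntg1.
have NUg1 : g1 \in 'N_G(U) by rewrite groupX.
have /setIP[Gg NUg] : g \in 'N_G(U) by apply: subsetP gg1; rewrite cycle_subG.
have ltsx : s < #[x].
  rewrite ltnNge; apply: contra nDns; apply: Dsmall (p_elt_constt s n) s_pr => //.
  by case/setIP: NUg1.
have pg : prime #[g] by rewrite og.
have nsx' : #[g] != #[x] by rewrite og neq_ltn ltsx.
have nDg : g \notin D.
  apply/negP=> Dg; have yg : g \in <[y]>.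
    by apply: Dp' => //; rewrite /p_elt pnatE // inE /= inE.
  have := order_dvd_cycle yg; rewrite dvdn_prime2 // og => /eqP e.
  by move: ltsx; rewrite e ltnNge ltnW.
have nUG : <[g]> \subset 'N(U) by rewrite cycle_subG.
have nxG : <[g]> \subset 'N(<[x]>) by rewrite cycle_subG (subsetP (normal_norm nsx)).
have sxU : <[x]> \subset U by rewrite cycle_subG.
have sUG : U \subset G := subset_trans sUD (subsetIl _ _).
have coUg : coprime #|U| #|<[g]>|.
  by apply: pnat_coprime pU _; rewrite -orderE pnatE // inE /= inE.
have nxU : U \subset 'N(<[x]>) := subset_trans sUG (normal_norm nsx).
(* Commutators act trivially on <y>, so [U, g] lies in C_U(y), which is inside <x>. Thus g
   centralises U/<x>, and coprime action lifts this to elements of C_U(g) outside <x>. *)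
have cUxg : <[g]> / <[x]> \subset 'C(U / <[x]>).
  rewrite quotient_cents2 //; apply: subset_trans (_ : 'C_U(<[y]>) \subset _).
    rewrite subsetI commg_subr nUG /=.
    apply: subset_trans (der1_cent_cyclic (cycle_cyclic y) (normal_norm nsy)).
    by rewrite commgSS ?cycle_subG.
  apply/subsetP=> u /setIP[Uu]; rewrite cent_cycle => /cent1P cyu.
  apply: (tame_cent_p' tG Gy Gx) => //; rewrite 1?eq_sym //.
    exact: (subsetP sUG).
  by rewrite /p_elt (pi_pnat (mem_p_elt pU Uu)) // inE /= inE.
have /subsetPn[c /setIP[Uc cgc] nxc] : ~~ ('C_U(<[g]>) \subset <[x]>).
  apply: contra nUx => sCx; rewrite -quotient_sub1 //.
  have <- := quotientS1 sCx.
  rewrite (coprime_quotient_cent sxU nxG coUg (solvableS sUG solG)).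
  by rewrite subsetI subxx centsC.
have [c0 cc0 [oc0 nxc0]] : exists2 c0, c0 \in <[c]> & #[c0] = #[x] /\ c0 \notin <[x]>.
  have ntc : c != 1 by apply: contraNneq nxc => ->; apply: group1.
  have [_ [c0 cc0 oc0]] := p_elt_prime_order (mem_p_elt pU Uc) ntc.
  exists c0 => //; split=> //; apply: contra nxc => xc0.
  have e : <[c0]> = <[x]>.
    by apply: prime_order_eq_cycle; rewrite // -order_gt1 oc0 prime_gt1.
  rewrite -(_ : <[c]> = <[x]>) ?cycle_id //.
  apply: (tame_root tG Gx Gy) => //; first exact: (subsetP sUG).
    exact: mem_p_elt pU Uc.
  by rewrite -cycle_subG -e cycle_subG.
have Uc0 : c0 \in U by apply: subsetP cc0; rewrite cycle_subG.
have cc0g : commute c0 g.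
  have ccg : commute c g by apply/cent1P; rewrite -cent_cycle.
  by case/cycleP: cc0 => i ->; apply/commute_sym/commuteX/commute_sym.
have cc0x : commute c0 x by apply: (centsP abU).
have Gc0 := subsetP sUG c0 Uc0.
have pc0 : prime #[c0] by rewrite oc0.
have nc0g : #[c0] != #[g] by rewrite oc0 eq_sym.
have [_ uniq] := tG c0 g Gc0 Gg pc0 pg nc0g cc0g.
(* Since x commutes with c0, both g and g^x centralise c0, and uniqueness at c0 applies. Then x and
   g normalise each other's cycles, so [x, g] lies in <x> :&: <g> = 1, although g is outside D. *)
have egx : <[g ^ x]> = <[g]>.
  apply: uniq; rewrite ?groupJ ?orderJ //; first by rewrite eq_sym.
  by rewrite /commute -(conjg_fixP (introT commgP cc0x)) -!conjMg cc0g.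
have ngx : x \in 'N(<[g]>) by rewrite inE -cycleJ egx.
have tixg : <[x]> :&: <[g]> = 1.
  by rewrite coprime_TIg // -!orderE prime_coprime // dvdn_prime2 // eq_sym.
have sRxg : [~: <[x]>, <[g]>] \subset <[x]> :&: <[g]>.
  by rewrite commg_subI // subsetI subxx ?nxG // cycle_subG.
have := subsetP sRxg _ (mem_commg (cycle_id x) (cycle_id g)).
rewrite tixg => /set1P/eqP/commgP cxg.
by case/negP: nDg; rewrite inE Gg /=; apply/cent1P.
Qed.

(** Here p = |y| and q = |x|. As [x] is central, all q'-elements lie in <y>, so G is <y> times a
    Sylow q-subgroup U, and the splitting U = <x> \x <v> makes <x> the direct factor C_q. *)
Lemma Fitting_pq_times_q (gT : finGroupType) (G : {group gT}) (x y : gT) :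
  solvable G -> tame G -> prime #[x] -> prime #[y] -> #[x] < #[y] ->
  <[x]> \x <[y]> = 'F(G) -> ~~ ('C_G[x] \subset 'F(G)) ->
  exists p q n : nat, distinct_primes [:: p; q] /\ case_pq_times_q G p q n.
Proof.
move=> solG tG px py ltxy defF nCxF.
have cGx := Fitting_pq_central solG tG px py ltxy defF nCxF.
have [Fx Fy cxy] := dprod_cycle_mem defF.
have nxy: #[x] != #[y] by rewrite neq_ltn ltxy.
have [nsx nsy] := Fitting_prime_cycles_normal px py nxy defF.
have sFG := Fitting_sub G; have [Gx Gy] := (subsetP sFG x Fx, subsetP sFG y Fy).
have Gp' d : d \in G -> #[x]^'.-elt d -> d \in <[y]>.
  move=> Gd; apply: (tame_cent_p' tG Gx Gy px py) => //.
  by apply/commute_sym/cent1P/(subsetP cGx).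
have [U sylU] := Sylow_exists #[x] G.
have [sUG pU _] := and3P sylU.
have Ux : x \in U.
  rewrite -cycle_subG (normal_sub_max_pgroup (Hall_max sylU)) //.
  by rewrite /pgroup -orderE pnat_id.
have nyG := normal_norm nsy.
have nyU : U \subset 'N(<[y]>) := subset_trans sUG nyG.
have pGy : #[x].-group (G / <[y]>).
  apply/pgroupP=> r r_pr /(Cauchy r_pr)[_ /morphimP[g ng Gg ->] org].
  have Ngp (pi : nat_pred) : g.`_pi \in 'N(<[y]>) by rewrite groupX.
  have yg : g.`_(#[x])^' \in <[y]> by rewrite Gp' ?groupX ?p_elt_constt.
  have : #[x].-elt (coset <[y]> g).
    rewrite -(consttC #[x] g) morphM //= (coset_id yg) mulg1.
    by rewrite morph_p_elt // p_elt_constt.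
  by rewrite /p_elt org pnatE.
have nx'y : #[y] \in #[x]^' by rewrite inE /= inE eq_sym.
have tiyU : <[y]> :&: U = 1.
  rewrite coprime_TIg // coprime_sym; apply: pnat_coprime pU _.
  by rewrite -orderE pnatE.
have defG : <[y]> * U = G.
  have syG : <[y]> \subset G by rewrite cycle_subG.
  apply/eqP; rewrite eqEcard mul_subG //= TI_cardMg //.
  rewrite (card_Hall sylU) -(Lagrange syG) -(card_quotient nyG).
  rewrite leq_mul2l partnM ?cardG_gt0 // -orderE (part_pnat_id pGy).
  by rewrite leq_pmull ?orbT // part_gt0.
have nUx : ~~ (U \subset <[x]>).
  apply: contra nCxF => sUx; apply: subset_trans (subsetIl _ _) _.
  by rewrite -{1}defG mul_subG ?cycle_subG // (subset_trans sUx) ?cycle_subG.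
have sUC : U \subset 'C_G[x] by rewrite subsetI sUG (subset_trans sUG).
have [v ntv defU] := Fitting_pq_Sylow_split tG px py nxy Gx Gy cxy nsy sUC pU Ux nUx.
have [_ mulU cvx tixv] := dprodP defU.
have svU : <[v]> \subset U by rewrite -mulU mulG_subr.
have Uv : v \in U by rewrite -cycle_subG.
have tiyv : <[y]> :&: <[v]> = 1 by apply/trivgP; rewrite -tiyU setIS.
have nyv : <[v]> \subset 'N(<[y]>) := subset_trans svU nyU.
have [n ov] := p_natP (mem_p_elt pU Uv).
exists #[y], #[x], n; split; first by rewrite /distinct_primes /= px py !inE eq_sym nxy.
exists <[y]>%G, <[v]>%G, (<[y]> <*> <[v]>)%G, <[x]>%G.
rewrite /cyclic_of_order !cycle_cyclic -!orderE ov !eqxx; split; split=> //.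
- by rewrite sdprodEY.
- have defL : <[y]> * <[v]> = <[y]> <*> <[v]> by rewrite norm_joinEr.
  have mulLx : (<[y]> <*> <[v]>) * <[x]> = G.
    by rewrite -defL -mulgA -defG -mulU (centC cvx).
  have cLx : <[x]> \subset 'C(<[y]> <*> <[v]>).
    rewrite centsC cent_cycle (subset_trans _ cGx) // join_subG !cycle_subG Gy.
    exact: (subsetP sUG).
  have oL : #|<[y]> <*> <[v]>| = (#[y] * #[v])%N by rewrite -defL TI_cardMg.
  have oG : #|G| = (#[y] * (#[x] * #[v]))%N.
    by rewrite -defG TI_cardMg // -mulU TI_cardMg.
  rewrite dprodE // cardMg_TI // mulLx oG oL.
  by rewrite -mulnA [(#[v] * _)%N]mulnC.
(* A fixed point f != 1 generates <y>, so w centralises [y]; by [tame_cent_p'] at [y] it lies in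
   <x>, which meets <v> trivially. *)
move=> n_gt0 w /setD1P[ntw vw]; apply/trivgP/subsetP=> f /setIP[qf /cent1P cwf].
rewrite inE; apply: contraR ntw => ntf.
have Ff : f \in 'F(G) := subsetP (pcore_sub _ _) f qf.
have Gf := subsetP sFG f Ff.
have yf : f \in <[y]>.
  by rewrite Gp' //; apply: pi_pnat (mem_p_elt (pcore_pgroup _ _) qf) nx'y.
have Uw : w \in U by apply: (subsetP svU).
have ey : <[f]> = <[y]> by apply: prime_order_eq_cycle.
have cyw : commute y w.
  have : y \in <[f]> by rewrite ey cycle_id.
  by case/cycleP=> i ->; apply/commute_sym/commuteX.
have xw : w \in <[x]>.
  apply: (tame_cent_p' tG Gy Gx) => //; rewrite 1?eq_sym ?(subsetP sUG) //.
  by rewrite /p_elt (pi_pnat (mem_p_elt pU Uw)) // inE /= inE.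
by rewrite -in_set1 -[[set 1]]tixv inE xw.
Qed.

Lemma Fitting_not_pgroup_cases (gT : finGroupType) (G : {group gT}) :
  solvable G -> tame G -> (forall p : nat, prime p -> ~~ p.-group 'F(G)) ->
  (exists p q n : nat, distinct_primes [:: p; q] /\ case_pq_times_q G p q n) \/
  (exists p q r n : nat,
     distinct_primes [:: p; q; r] /\ case_pq_by_r G p q r n) \/
  (exists p q r s : nat,
     distinct_primes [:: p; q; r; s] /\ case_rs_by_pq G p q r s).
Proof.
move=> solG tG npF.
have [x [y [px py nxy defF]]] :=
  tame_nilpotent (tameS (Fitting_sub G) tG) (Fitting_nil G) npF.
have {nxy} : exists x' y' : gT, [/\ prime #[x'], prime #[y'], #[x'] < #[y']
                                  & <[x']> \x <[y']> = 'F(G)].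
  case: (ltngtP #[x] #[y]) nxy => // lt _; [exists x, y | exists y, x] => //.
  by rewrite dprodC.
case=> x' [y' [px' py' lt defF']].
have [sCF|nCF] := boolP ('C_G[x'] \subset 'F(G)).
  by right; apply: Fitting_pq_Frobenius lt defF' sCF.
by left; apply: Fitting_pq_times_q lt defF' nCF.
Qed.

(** * Fitting subgroups of prime power order *)

(** Conjugates of [y] under [A] still centralise [f], so uniqueness at [f] makes [A] normalise <y>;
    then [A, y] lies in A :&: <y> = 1. *)
Lemma tame_cent_pgroup (gT : finGroupType) (G A : {group gT}) (f y : gT) :
  tame G -> f \in G -> y \in G -> prime #[f] -> prime #[y] -> #[f] != #[y] ->
  commute f y -> A \subset 'C_G[f] -> #[f].-group A -> y \in 'N(A) -> y \in 'C(A).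
Proof.
move=> tG Gf Gy pf py nfy cfy sAC fA nAy.
have tiAy : A :&: <[y]> = 1.
  by rewrite coprime_TIg // (pnat_coprime fA) // -orderE pnatE // inE /= inE eq_sym.
have nyA : A \subset 'N(<[y]>).
  apply/subsetP=> a Aa; have /setIP[Ga /cent1P caf] := subsetP sAC a Aa.
  rewrite inE -cycleJ; have [_ uniq] := tG f y Gf Gy pf py nfy cfy.
  rewrite (uniq (y ^ a)) ?groupJ ?orderJ //; first by rewrite eq_sym.
  by rewrite /commute -(conjg_fixP (introT commgP (commute_sym caf))) -!conjMg cfy.
have : [~: A, <[y]>] \subset A :&: <[y]>.
  by rewrite commg_subI // subsetI subxx ?nyA // cycle_subG.
rewrite tiAy => /trivgP/commG1P; rewrite centsC cycle_subG; exact.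
Qed.

(** [tame_cent_pgroup] is used twice: a fixed point f makes [y] centralise Z(F), since Z(F) lies in
    C_F(f); then a nontrivial z in Z(F) makes [y] centralise C_F(z) = F. So [y] lies in F, against
    its order. *)
Lemma cent1_Fitting_prime (gT : finGroupType) (G : {group gT}) (r : nat) (y : gT) :
  solvable G -> tame G -> r.-group 'F(G) -> y \in G -> prime #[y] -> #[y] != r ->
  'C_('F(G))[y] = 1.
Proof.
move=> solG tG rF Gy py nyr; apply/trivgP/subsetP=> f /setIP[Ff /cent1P cfy].
rewrite inE; apply/idPn=> ntf.
have sFG := Fitting_sub G; have nFG := normal_norm (Fitting_normal G).
have nFy : y \in 'N('F(G)) := subsetP nFG y Gy.
have cent (A : {group gT}) f1 : f1 \in 'F(G) -> f1 != 1 -> commute f1 y ->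
  A \subset 'C_('F(G))[f1] -> y \in 'N(A) -> y \in 'C(A).
  move=> Ff1 ntf1 cf1y sAC nAy.
  have [r_pr [f0 ff0 of0]] := p_elt_prime_order (mem_p_elt rF Ff1) ntf1.
  have Ff0 : f0 \in 'F(G) by apply: subsetP ff0; rewrite cycle_subG.
  have sAF := subset_trans sAC (subsetIl _ _).
  apply: (tame_cent_pgroup (f := f0) tG) => //; rewrite ?of0 1?eq_sym //.
  - exact: (subsetP sFG).
  - by case/cycleP: ff0 => i ->; apply/commute_sym/commuteX.
  - rewrite subsetI (subset_trans sAF) //=; apply: subset_trans sAC _.
    apply/subsetP=> u /setIP[_ /cent1P cuf1]; apply/cent1P.
    by case/cycleP: ff0 => i ->; apply: commuteX.
  exact: pgroupS sAF rF.
have cyZ : y \in 'C('Z('F(G))).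
  apply: (cent _ f) => //; last by rewrite (subsetP _ y nFy) // char_norms ?center_char.
  by rewrite setIS // -cent_cycle centS // cycle_subG.
have ntF : 'F(G) != 1 by apply: contraNneq ntf => F1; move: Ff; rewrite /= F1 inE.
have /trivgPn[z Zz ntz] : 'Z('F(G)) != 1.
  apply: contra ntF => /eqP Z1.
  by rewrite (TI_center_nil (Fitting_nil G) (normal_refl _)) // Z1 setIg1.
have /setIP[Fz cFz] := Zz.
have cFy : y \in 'C('F(G)).
  apply: (cent _ z) => //; first by apply/commute_sym/(centP cyZ).
  by rewrite subsetI subxx sub_cent1.
have Fy : y \in 'F(G).
  by rewrite (subsetP (solvable_cent_Fitting solG)) // inE Gy.
by have := mem_p_elt rF Fy; rewrite /p_elt pnatE // inE /= (negPf nyr).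
Qed.

Lemma Fitting_semiregular (gT : finGroupType) (G X : {group gT}) (r : nat) :
  solvable G -> tame G -> r.-group 'F(G) -> X \subset G -> r^'.-group X ->
  semiregular 'F(G) X.
Proof.
move=> solG tG rF sXG r'X x /setD1P[ntx Xx].
have p_pr : prime (pdiv #[x]) by rewrite pdiv_prime ?order_gt1.
have [y xy oy] := @Cauchy _ _ <[x]> p_pr (pdiv_dvd _).
have Xy : y \in X by apply: subsetP xy; rewrite cycle_subG.
apply/trivgP; rewrite -(@cent1_Fitting_prime _ G r y) ?oy ?(subsetP sXG) //.
  by rewrite setIS //= -(cent_cycle x) -(cent_cycle y) centS // cycle_subG.
by have := mem_p_elt r'X Xy; rewrite /p_elt oy pnatE.
Qed.

(* [C_F(b)] is nontrivial when [b] is an [r]-element, and [tame_cent_pgroup]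
   shows that [y] centralises it. *)
Lemma Fitting_no_commuting_prime (gT : finGroupType) (G : {group gT}) (r : nat)
    (b y : gT) :
  solvable G -> tame G -> r.-group 'F(G) -> 'F(G) != 1 -> b \in G -> y \in G ->
  #[b] = r -> prime r -> prime #[y] -> #[y] != r -> ~ commute b y.
Proof.
move=> solG tG rF ntF Gb Gy ob r_pr py nyr cby.
have nFG := normal_norm (Fitting_normal G).
have nFb : <[b]> \subset 'N('F(G)) by rewrite cycle_subG (subsetP nFG).
have rP : r.-group ('F(G) <*> <[b]>).
  by rewrite norm_joinEr // pgroupM rF /pgroup -orderE ob pnat_id.
have nsFP : 'F(G) <| 'F(G) <*> <[b]>.
  by rewrite /normal joing_subl join_subG normG.
have ntC := meet_center_nil (pgroup_nil rP) nsFP ntF.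
have sCC : 'F(G) :&: 'Z('F(G) <*> <[b]>) \subset 'C_('F(G))[b].
  rewrite setIS //; apply: subset_trans (subsetIr _ _) _.
  by rewrite -cent_cycle centS // joing_subr.
suffices C1 : 'C_('F(G))[b] \subset [1].
  by case/negP: ntC; rewrite -subG1 (subset_trans sCC).
rewrite -(cent1_Fitting_prime solG tG rF Gy py nyr) subsetI subsetIl /=.
rewrite sub_cent1; apply: (@tame_cent_pgroup _ G _ b) => //; rewrite ?ob 1?eq_sym //.
- by rewrite setSI // Fitting_sub.
- by apply: pgroupS rF; apply: subsetIl.
apply/normP; rewrite conjIg (normP (subsetP nFG y Gy)) -cent1J.
by rewrite (conjg_fixP (introT commgP cby)).
Qed.

Lemma Fitting_no_commuting (gT : finGroupType) (G : {group gT}) (r : nat) (b y : gT) :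
  solvable G -> tame G -> r.-group 'F(G) -> 'F(G) != 1 -> b \in G -> y \in G ->
  r.-elt b -> r^'.-elt y -> y != 1 -> commute b y -> b = 1.
Proof.
move=> solG tG rF ntF Gb Gy rb r'y nty cby; apply/eqP/idPn=> ntb.
have [r_pr [b0 bb0 ob0]] := p_elt_prime_order rb ntb.
have p_pr : prime (pdiv #[y]) by rewrite pdiv_prime ?order_gt1.
have [y0 yy0 oy0] := @Cauchy _ _ <[y]> p_pr (pdiv_dvd _).
have r'y0 := mem_p_elt r'y yy0.
apply: (@Fitting_no_commuting_prime _ G r b0 y0) => //; rewrite ?oy0 //.
- by apply: subsetP bb0; rewrite cycle_subG.
- by apply: subsetP yy0; rewrite cycle_subG.
- by move: r'y0; rewrite /p_elt oy0 pnatE.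
by case/cycleP: bb0 => i ->; case/cycleP: yy0 => j ->; apply: commuteX2.
Qed.

(** The r'-part y1 of a representative still represents [y], and it normalises the preimage P of
    <b>, which is an r-group. Coprime action then lifts [b] to an element of P commuting with y1. *)
Lemma Fitting_quotient_no_commuting (gT : finGroupType) (G : {group gT}) (r : nat)
    (b y : coset_of 'F(G)) :
  solvable G -> tame G -> r.-group 'F(G) -> 'F(G) != 1 ->
  b \in G / 'F(G) -> y \in G / 'F(G) ->
  r.-elt b -> r^'.-elt y -> y != 1 -> commute b y -> b = 1.
Proof.
move=> solG tG rF ntF Gb Gy rb r'y nty cby; apply/eqP/idPn=> ntb.
have nsFG := Fitting_normal G; have nFG := normal_norm nsFG.
have [y0 ny0 Gy0 ey0] := morphimP Gy; set y1 := y0.`_r^'.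
have Gy1 : y1 \in G by rewrite groupX.
have ey1 : y = coset 'F(G) y1.
  by rewrite morph_constt // -ey0 constt_p_elt.
pose P := (coset 'F(G) @*^-1 <[b]>)%G.
have sFP : 'F(G) \subset P by apply: sub_cosetpre.
have sPG : P \subset G by rewrite sub_cosetpre_quo // cycle_subG.
have PF : P / 'F(G) = <[b]> by rewrite cosetpreK.
have rP : r.-group P.
  by rewrite -(pquotient_pgroup rF) ?PF ?(subset_trans sPG).
have nFy1 : y1 \in 'N('F(G)) := subsetP nFG y1 Gy1.
have nPy1 : <[y1]> \subset 'N(P).
  rewrite cycle_subG; apply: (subsetP (morphpre_norm _ _)).
  rewrite mem_morphpre //= -ey1; apply: (subsetP (cent_sub _)).
  by rewrite cent_cycle; apply/cent1P/commute_sym.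
have nFy1s : <[y1]> \subset 'N('F(G)) by rewrite cycle_subG.
have r'y1 : r^'.-elt y1 by apply: p_elt_constt.
have coPy : coprime #|P| #|<[y1]>| by apply: pnat_coprime rP _; rewrite -orderE.
have eC := coprime_quotient_cent sFP nFy1s coPy (pgroup_sol rP).
have : b \in 'C_(P / 'F(G))(<[y1]> / 'F(G)).
  rewrite PF inE cycle_id quotient_cycle // -ey1 cent_cycle.
  by apply/cent1P.
rewrite -eC => /morphimP[c nFc /setIP[Pc cyc] ebc].
have nty1 : y1 != 1 by apply: contraNneq nty => y11; rewrite ey1 y11 morph1.
have c1 : c = 1.
  apply: (Fitting_no_commuting solG tG rF ntF _ Gy1 _ r'y1) => //.
  - exact: (subsetP sPG).
  - exact: mem_p_elt rP Pc.
  by apply/cent1P; rewrite -cent_cycle.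
by case/eqP: ntb; rewrite ebc c1 morph1.
Qed.

(** * Groups acting semiregularly on a nontrivial nilpotent group *)

Definition regular_on (gT : finGroupType) (F X : {group gT}) : Prop :=
  [/\ nilpotent F, F :!=: 1, X \subset 'N(F) & semiregular F X].

Lemma regular_on_prime_pair (gT : finGroupType) (F X : {group gT}) (z y : gT) :
  regular_on F X -> z \in X -> y \in X -> y \in 'N(<[z]>) ->
  prime #[z] -> prime #[y] ->
  (#[z] != #[y] -> commute z y) /\ (#[z] = #[y] -> <[z]> = <[y]>).
Proof.
case=> nilF ntF nFX regX Xz Xy nzy pz py.
have sX : <[z]> <*> <[y]> \subset X by rewrite join_subG !cycle_subG Xz.
apply: (@semiregular_prime_pair _ F) => //; first exact: subset_trans nFX.
exact: semiregularS regX.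
Qed.

(** Take z of prime order below a primary part outside T. If |z| is |a| or |b|, then z generates
    that cycle and the root clause confines the primary part to T. Otherwise z commutes with [a],
    and uniqueness at [a] gives <z> = <b>, a contradiction. *)
Lemma regular_on_pq (gT : finGroupType) (F X T : {group gT}) (a b : gT) :
  regular_on F X -> tame X -> T <| X -> prime #[a] -> prime #[b] ->
  #[a] != #[b] -> <[a]> \x <[b]> = T -> X \subset T.
Proof.
move=> regX tX nsTX pa pb nab defT.
have [Ta Tb cab] := dprod_cycle_mem defT.
have [cycT _] := dprod_prime_cycles pa pb nab defT.
have sTX := normal_sub nsTX; have [Xa Xb] := (subsetP sTX a Ta, subsetP sTX b Tb).
have nT u : u \in T -> X \subset 'N(<[u]>).
  move=> Tu; apply: normal_norm; apply: char_normal_trans nsTX.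
  by rewrite sub_cyclic_char // cycle_subG.
apply/subsetP=> y Xy; apply/idPn=> /constt_notin[u nTyu].
have Xyu : y.`_u \in X by rewrite groupX.
have ntyu : y.`_u != 1 by apply: contraNneq nTyu => ->.
have [u_pr [z yz oz]] := p_elt_prime_order (p_elt_constt u y) ntyu.
have Xz : z \in X by apply: subsetP yz; rewrite cycle_subG.
have pz : prime #[z] by rewrite oz.
have pair c : c \in T -> prime #[c] ->
    (#[c] != #[z] -> commute c z) /\ (#[c] = #[z] -> <[c]> = <[z]>).
  move=> Tc pc; apply: (regular_on_prime_pair regX) => //.
    exact: (subsetP sTX).
  exact: (subsetP (nT c Tc)).
have bad c d : c \in T -> d \in T -> prime #[c] -> prime #[d] -> #[c] != #[d] ->
    commute c d -> #[c] = #[z] -> False.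
  move=> Tc Td pc pd ncd ccd ecz; case/negP: nTyu.
  have e : <[y.`_u]> = <[c]>.
    apply: (tame_root (x := d) tX) => //; rewrite ?(subsetP sTX) //.
      by rewrite ecz oz p_elt_constt.
    by rewrite -cycle_subG (proj2 (pair c Tc pc) ecz) cycle_subG.
  by rewrite -cycle_subG e cycle_subG.
have [eaz|naz] := eqVneq #[a] #[z]; first exact: (bad a b).
have [ebz|nbz] := eqVneq #[b] #[z].
  by apply: (bad b a) => //; rewrite eq_sym.
have caz := proj1 (pair a Ta pa) naz.
have [_ uniq] := tX a b Xa Xb pa pb nab cab.
have ezb : <[z]> = <[b]> by apply: uniq => //; rewrite eq_sym.
by case/eqP: nbz; rewrite !orderE ezb.
Qed.

(** A central z of order s has its cycle normalised by every y of order s, so the equal-order half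
    of [regular_on_prime_pair] gives <y> = <z>. *)
Lemma regular_on_Ohm1 (gT : finGroupType) (F T : {group gT}) (s : nat) :
  regular_on F T -> prime s -> s.-group T -> T :!=: 1 ->
  exists2 z, #[z] = s & 'Ohm_1(T) = <[z]>.
Proof.
move=> regT s_pr sT ntT.
have /trivgPn[z0 Zz0 ntz0] : 'Z(T) != 1.
  apply: contra ntT => /eqP Z1.
  by rewrite (TI_center_nil (pgroup_nil sT) (normal_refl _)) // Z1 setIg1.
have sZ : s.-group 'Z(T) := pgroupS (center_sub T) sT.
have [_ [z zz0 oz]] := p_elt_prime_order (mem_p_elt sZ Zz0) ntz0.
have /setIP[Tz cTz] : z \in 'Z(T) by apply: subsetP zz0; rewrite cycle_subG.
exists z => //; rewrite Ohm1Eprime; apply/eqP; rewrite eqEsubset !gen_subG.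
rewrite sub1set mem_gen; last by rewrite inE Tz oz.
rewrite andbT; apply/subsetP=> y; rewrite inE => /andP[Ty py].
have oy : #[y] = s.
  by have := mem_p_elt sT Ty; rewrite /p_elt pnatE // => /eqP.
have nzy : y \in 'N(<[z]>).
  apply: (subsetP (cent_sub _)); rewrite cent_cycle; apply/cent1P/commute_sym.
  exact: (centP cTz).
have pz : prime #[z] by rewrite oz.
have [_ eq] := regular_on_prime_pair regT Tz Ty nzy pz py.
by rewrite -cycle_subG -eq ?oz.
Qed.

Lemma regular_on_pgroup (gT : finGroupType) (F T : {group gT}) (s : nat) :
  regular_on F T -> prime s -> s.-group T -> T :!=: 1 ->
  cyclic T \/ s = 2 /\ exists2 n, 2 < n & T \isog 'Q_(2 ^ n).
Proof.
move=> regT s_pr sT ntT; have [z oz O1T] := regular_on_Ohm1 regT s_pr sT ntT.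
have oO1 : #|'Ohm_1(T)| = s by rewrite O1T -orderE oz.
have := introT (prime_Ohm1P sT ntT) oO1.
case/orP=> [cycT|/andP[/eqP s2 /eqP/quaternion_classP]].
  by left.
by right.
Qed.

(** Coprime action on the abelian T leaves no nontrivial fixed point in [T, y]; but a nontrivial
    [T, y] would contain <z>, the least nontrivial subgroup of the cyclic s-group T. *)
Lemma cyclic_pgroup_cent (gT : finGroupType) (T : {group gT}) (s : nat) (z y : gT) :
  prime s -> s.-group T -> cyclic T -> z \in T -> #[z] = s ->
  y \in 'N(T) -> s^'.-elt y -> commute z y -> y \in 'C(T).
Proof.
move=> s_pr sT cycT Tz oz nTy s'y czy.
have nTyc : <[y]> \subset 'N(T) by rewrite cycle_subG.
have co : coprime #|T| #|<[y]>| by apply: pnat_coprime sT _; rewrite -orderE.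
have TI := coprime_abel_cent_TI nTyc co (cyclic_abelian cycT).
have sRT : [~: T, <[y]>] \subset T by rewrite commg_subl.
have R1 : [~: T, <[y]>] = 1.
  apply/eqP/idPn => ntR.
  have sR := pgroupS sRT sT.
  have [_ sdR _] := pgroup_pdiv sR ntR.
  have zR : <[z]> \subset [~: T, <[y]>].
    by rewrite -(cardSg_cyclic cycT) ?cycle_subG // -orderE oz.
  have : z \in 'C_[~: T, <[y]>](<[y]>).
    by rewrite inE -cycle_subG zR cent_cycle; apply/cent1P.
  by rewrite TI => /set1P z1; move: s_pr; rewrite -oz z1 order1.
by rewrite -cycle_subG centsC; apply/commG1P.
Qed.

(** An element of prime order other than s normalises, hence centralises, the subgroup of order s in
    T; so it centralises T and would lie in T. *)
Lemma regular_on_cyclic (gT : finGroupType) (F X T : {group gT}) (s : nat) :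
  regular_on F X -> T <| X -> prime s -> s.-group T -> T :!=: 1 -> cyclic T ->
  'C_X(T) \subset T -> s.-group X.
Proof.
move=> regX nsTX s_pr sT ntT cycT sCT.
have [_ [z0 T0 oz]] : prime s /\ exists2 z, z \in T & #[z] = s.
  have [_ sd _] := pgroup_pdiv sT ntT.
  by split=> //; have [z] := Cauchy s_pr sd; exists z.
have sTX := normal_sub nsTX; have Xz := subsetP sTX z0 T0.
have nzX : X \subset 'N(<[z0]>).
  apply: normal_norm; apply: char_normal_trans nsTX.
  by rewrite sub_cyclic_char // cycle_subG.
apply/pgroupP=> u u_pr /(Cauchy u_pr)[y Xy oy].
rewrite !inE; apply/idPn=> nus.
have pz : prime #[z0] by rewrite oz.
have py : prime #[y] by rewrite oy.
have [comm _] := regular_on_prime_pair regX Xz Xy (subsetP nzX y Xy) pz py.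
have s'y : s^'.-elt y by rewrite /p_elt oy pnatE // !inE.
have cTy : y \in 'C(T).
  apply: (cyclic_pgroup_cent s_pr sT cycT T0 oz) => //.
    exact: (subsetP (normal_norm nsTX)).
  by apply: comm; rewrite oz oy eq_sym.
have Ty : y \in T by rewrite (subsetP sCT) // inE Xy.
by have := mem_p_elt sT Ty; rewrite /p_elt oy pnatE // inE (negPf nus).
Qed.

(* The involution of [T] is central in [X] and a square in [T]. *)
Lemma regular_on_quaternion (gT : finGroupType) (F X T : {group gT}) (z : gT) :
  regular_on F X -> tame X -> T <| X -> 2.-group T -> ~~ cyclic T ->
  #[z] = 2 -> 'Ohm_1(T) = <[z]> -> 2.-group X.
Proof.
move=> regX tX nsTX sT ncycT oz O1T.
have sTX := normal_sub nsTX.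
have Tz : z \in T by rewrite -cycle_subG -O1T Ohm_sub.
have Xz := subsetP sTX z Tz.
have nzX : X \subset 'N(<[z]>).
  by rewrite -O1T; apply: normal_norm (char_normal_trans (Ohm_char 1 T) nsTX).
have [a Ta nza] : exists2 a, a \in T & a \notin <[z]>.
  apply/subsetPn; apply: contra ncycT => sTz.
  by apply: cyclicS sTz (cycle_cyclic z).
have nta : a != 1 by apply: contraNneq nza => ->.
have [_ [z1 az1 oz1]] := p_elt_prime_order (mem_p_elt sT Ta) nta.
have ez1 : <[z1]> = <[z]>.
  apply: prime_order_eq_cycle; rewrite ?oz //; last by rewrite -order_gt1 oz1.
  rewrite -O1T Ohm1Eprime mem_gen // inE oz1 andbT.
  by apply: subsetP az1; rewrite cycle_subG.
apply/pgroupP=> u u_pr /(Cauchy u_pr)[y Xy oy].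
rewrite !inE; apply/idPn=> nu2.
have pz : prime #[z] by rewrite oz.
have py : prime #[y] by rewrite oy.
have nzy : #[z] != #[y] by rewrite oz oy eq_sym.
have [comm _] := regular_on_prime_pair regX Xz Xy (subsetP nzX y Xy) pz py.
(* An odd-order y commuting with z makes [tame_root] available at z, so no 2-element lies strictly
   above <z>, whereas a does. *)
case/negP: nza; suffices <- : <[a]> = <[z]> by apply: cycle_id.
apply: (tame_root tX Xz Xy pz py nzy (comm nzy) (subsetP sTX a Ta)).
  by rewrite oz (mem_p_elt sT Ta).
by rewrite -cycle_subG -ez1 cycle_subG.
Qed.

(** [A] is the group of automorphisms that X induces on F, L is G/F itself, and [phi] the identity.
    Conjugation [q] and the coset map [f] are both injective on X, so [psi] is f composed with the
    inverse of q. *)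
Lemma fpf_group_of_complement (gT : finGroupType) (G X : {group gT}) (r m : nat)
    (R : {group coset_of 'F(G)}) :
  X \subset G -> 'F(G) != 1 -> semiregular 'F(G) X -> cyclic X ->
  X / 'F(G) ><| R = G / 'F(G) -> cyclic_of_order R (r ^ m) ->
  semiregular (X / 'F(G)) R -> case_cyclic_fpf G r #|X| m.
Proof.
move=> sXG ntF regX cycX defH cycR regR.
have nFX : X \subset 'N('F(G)) := subset_trans sXG (normal_norm (Fitting_normal G)).
have tiFX : 'F(G) :&: X = 1 by rewrite coprime_TIg ?regular_norm_coprime.
have cXF : 'C_X('F(G)) = 1.
  apply/trivgP/subsetP=> x /setIP[Xx cFx]; rewrite inE; apply: contraR ntF => ntx.
  rewrite -(regX x) ?inE ?ntx //; apply/eqP/esym/setIidPl.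
  by rewrite sub_cent1.
pose q := restrm_morphism nFX (conj_aut_morphism 'F(G)).
pose f := restrm_morphism nFX (coset_morphism 'F(G)).
have injq : 'injm q by rewrite ker_restrm ker_conj_aut cXF.
have injf : 'injm f by rewrite ker_restrm ker_coset setIC tiFX.
have sqf : 'ker q \subset 'ker f by apply: subset_trans injq (sub1G _).
pose A := (q @* X)%G.
pose psi := factm_morphism sqf (subxx X).
have psiE x : x \in X -> psi (q x) = f x by move=> Xx; apply: factmE.
exists A; split.
- split; first by rewrite /A /= morphim_restrm setIid Aut_conj_aut.
  move=> a /setD1P[nta /morphimP[x _ Xx ea]] u Fu; rewrite {}ea in nta * => xu.
  apply/eqP; rewrite -in_set1 -[[set 1]](regX x); last first.
    by rewrite !inE Xx andbT; apply: contraNneq nta => ->; rewrite morph1.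
  rewrite inE Fu; apply/cent1P/commgP/conjg_fixP.
  by rewrite -[RHS]xu /q /= /restrm norm_conj_autE // (subsetP nFX).
- by rewrite /cyclic_of_order morphim_cyclic //= card_injm.
exists (coset_of 'F(G)), (G / 'F(G))%G, (X / 'F(G))%G, R, psi, (idm_morphism _).
split; split=> //; last 1 first.
- move=> _ h /morphimP[x nXx Xx ->] _; rewrite psiE // => eh.
  exists x; split; [exact: (subsetP sXG) | exact: esym eh |].
  by move=> u Fu; rewrite /q /= /restrm norm_conj_autE // (subsetP nFX).
- apply/isomP; split; first exact: injm_factm.
  by rewrite /= morphim_factm // /f morphim_restrm setIid.
- exact: injm_idm.
by rewrite im_idm.
Qed.

(** Schur-Zassenhaus gives the complement R, an r-group, semiregular by
    [Fitting_quotient_no_commuting]. It is cyclic because it acts faithfully on a subgroup <k> of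
    prime order in X/F. *)
Lemma Fitting_pgroup_cyclic (gT : finGroupType) (G X : {group gT}) (r : nat) :
  solvable G -> tame G -> prime r -> r.-group 'F(G) -> 'F(G) != 1 ->
  r^'.-Hall(G) X -> X :!=: 1 -> cyclic X -> X / 'F(G) = 'F(G / 'F(G)) ->
  exists m, case_cyclic_fpf G r #|X| m.
Proof.
move=> solG tG r_pr rF ntF hallX ntX cycX defK.
have sXG := pHall_sub hallX; have r'X := pHall_pgroup hallX.
have nsFG := Fitting_normal G; have nFG := normal_norm nsFG.
have nFX : X \subset 'N('F(G)) := subset_trans sXG nFG.
have hallK : r^'.-Hall(G / 'F(G)) (X / 'F(G)) by apply: quotient_pHall.
have nsK : X / 'F(G) <| G / 'F(G) by rewrite defK Fitting_normal.
have /splitsP[R /complP[tiKR defH]] :=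
  SchurZassenhaus_split (pHall_Hall hallK) nsK.
have sRH : R \subset G / 'F(G) by rewrite -defH mulG_subr.
have sdH : X / 'F(G) ><| R = G / 'F(G).
  by rewrite sdprodE // (subset_trans sRH) ?normal_norm.
have rR : r.-group R.
  have hallR : r.-Hall(G / 'F(G)) R.
    by rewrite -(compl_p'Hall _ hallK); apply/complP; split.
  exact: pHall_pgroup hallR.
have [m oR] := p_natP rR.
have regR : semiregular (X / 'F(G)) R.
  move=> c /setD1P[ntc Rc]; apply/trivgP/subsetP=> k /setIP[Kk /cent1P cck].
  rewrite inE; apply: contraR ntc => ntk; apply/eqP.
  apply: (Fitting_quotient_no_commuting (y := k) solG tG rF ntF) => //.
  - exact: (subsetP sRH).
  - exact: (subsetP (normal_sub nsK)).
  - exact: mem_p_elt rR Rc.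
  - exact: mem_p_elt (pHall_pgroup hallK) Kk.
have tiFX : 'F(G) :&: X = 1 by rewrite coprime_TIg // (pnat_coprime rF).
have isoX := quotient_isog nFX tiFX.
have cycK : cyclic (X / 'F(G)) by rewrite -(isog_cyclic isoX).
have ntK : X / 'F(G) != 1 by rewrite -(isog_eq1 isoX).
have p_pr : prime (pdiv #|X / 'F(G)|) by rewrite pdiv_prime ?cardG_gt1.
have [k Kk ok] := Cauchy p_pr (pdiv_dvd _).
have pk : prime #[k] by rewrite ok.
have nRk : R \subset 'N(<[k]>).
  apply: subset_trans sRH _; apply: normal_norm; apply: char_normal_trans nsK.
  by rewrite sub_cyclic_char // cycle_subG.
have cycR : cyclic R.
  apply: (@cyclic_faithful_prime _ <[k]>) => //.
  apply/trivgP/subsetP=> c /setIP[Rc]; rewrite /= cent_cycle => cck; rewrite inE.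
  apply/idPn=> ntc; have : k \in 'C_(X / 'F(G))[c] by rewrite in_setI Kk cent1C.
  rewrite regR ?inE ?ntc // -order_eq1 => /eqP k1; by rewrite k1 in pk.
exists m; apply: (fpf_group_of_complement (R := R)) => //.
  exact: Fitting_semiregular r'X.
by rewrite /cyclic_of_order cycR oR eqxx.
Qed.

(** A normal subgroup of order 2 is central, so an r-element of G/F would commute with its
    r'-generator. Hence G/F is an r'-group, equal to the image of X; as a 2-group it is its own
    Fitting subgroup. *)
Lemma Fitting_pgroup_quaternion (gT : finGroupType) (G X : {group gT}) (r n : nat) :
  solvable G -> tame G -> prime r -> r.-group 'F(G) -> 'F(G) != 1 ->
  r^'.-Hall(G) X -> 2.-group X -> 2 < n ->
  'F(G / 'F(G)) \isog 'Q_(2 ^ n) -> r^'.-group 'F(G / 'F(G)) ->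
  #|'Ohm_1('F(G / 'F(G)))| = 2 -> case_quaternion G.
Proof.
move=> solG tG r_pr rF ntF hallX twoX n_gt2 isoQ r'B oO1.
have sXG := pHall_sub hallX; have r'X := pHall_pgroup hallX.
have nsFG := Fitting_normal G; have nFG := normal_norm nsFG.
have nFX : X \subset 'N('F(G)) := subset_trans sXG nFG.
set B := 'F(G / 'F(G)) in isoQ r'B oO1.
have nsZH : 'Ohm_1(B) <| G / 'F(G).
  by apply: char_normal_trans (Fitting_normal _); apply: Ohm_char.
have cZH h : h \in G / 'F(G) -> h \in 'C('Ohm_1(B)).
  move=> Hh; apply: coprime_Aut_cent; first exact: (subsetP (normal_norm nsZH)).
  by rewrite card_Aut_cyclic ?oO1 ?coprimen1 // prime_cyclic ?oO1.
have [z Zz ntz] : exists2 z, z \in 'Ohm_1(B) & z != 1.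
  by apply/trivgPn; rewrite -cardG_gt1 oO1.
have Bz : z \in B by apply: subsetP Zz; apply: Ohm_sub.
have r'z := mem_p_elt r'B Bz.
have r'H : r^'.-group (G / 'F(G)).
  apply/pgroupP=> u u_pr /(Cauchy u_pr)[h Hh oh]; rewrite !inE.
  apply/eqP=> eur; move: u_pr; rewrite -oh.
  rewrite (Fitting_quotient_no_commuting (y := z) solG tG rF ntF Hh) ?order1 //.
  - exact: (subsetP (Fitting_sub _)).
  - by rewrite /p_elt oh eur pnat_id.
  by apply: (centP (cZH h Hh)).
have hallH : X / 'F(G) = G / 'F(G).
  by apply: (pHall_id (quotient_pHall nFX hallX)).
have twoH : 2.-group (G / 'F(G)) by rewrite -hallH quotient_pgroup.
have defB : B = G / 'F(G) by apply: nilpotent_Fitting; apply: pgroup_nil twoH.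
split; first by exists n; rewrite -defB.
(* Any g outside F has to be treated. Its r'-part y is nontrivial because G/F has no r-elements, and
   fixed points of g are fixed by y. *)
move=> g /setDP[Gg nFg]; set y := g.`_r^'.
have Gy : y \in G by rewrite groupX.
have nty : y != 1.
  apply: contra nFg => /eqP/constt1P; rewrite p_eltNK => rg.
  apply: coset_idr; first exact: (subsetP nFG).
  have Ng : g \in 'N('F(G)) by apply: (subsetP nFG).
  apply/eqP; rewrite -order_eq1; apply/eqP; apply: (pnat_1 (pi := r)).
    exact: morph_p_elt.
  exact: mem_p_elt r'H (mem_quotient _ Gg).
have regy : semiregular 'F(G) <[y]>.
  apply: (Fitting_semiregular solG tG rF); first by rewrite cycle_subG.
  exact: p_elt_constt.
apply/trivgP; rewrite -(regy y) ?inE ?nty ?cycle_id // setIS //=.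
by rewrite -(cent_cycle y) -(cent_cycle g) centS // cycle_subG cycle_constt.
Qed.

Lemma Fitting_pgroup_cases (gT : finGroupType) (G : {group gT}) (r : nat) :
  solvable G -> tame G -> prime r -> r.-group 'F(G) -> ~~ r.-group G ->
  [\/ case_quaternion G,
      (exists p k m : nat,
         distinct_primes [:: p; r] /\ case_cyclic_fpf G r (p ^ k)%N m)
    | (exists p q m : nat,
         distinct_primes [:: p; q; r] /\ case_cyclic_fpf G r (p * q)%N m)].
Proof.
move=> solG tG r_pr rF nrG.
have nsFG := Fitting_normal G; have nFG := normal_norm nsFG.
have ntF : 'F(G) != 1.
  by rewrite trivg_Fitting //; apply: contraNneq nrG => ->; apply: pgroup1.
have [X hallX] := Hall_exists r^' solG.
have [sXG r'X _] := and3P hallX.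
have nFX : X \subset 'N('F(G)) := subset_trans sXG nFG.
have regF := Fitting_semiregular solG tG rF sXG r'X.
have regX : regular_on 'F(G) X by split=> //; apply: Fitting_nil.
have tX : tame X := tameS sXG tG.
have tiFX : 'F(G) :&: X = 1 by rewrite coprime_TIg // (pnat_coprime rF).
have hallXF : r^'.-Hall(G / 'F(G)) (X / 'F(G)) by apply: quotient_pHall.
set B := 'F(G / 'F(G))%G.
have solH : solvable (G / 'F(G)) by apply: quotient_sol.
have nsBH : B <| G / 'F(G) := Fitting_normal _.
(* F equals O_r(G), and G/O_r(G) has trivial r-core. *)
have r'B : r^'.-group B.
  have rB1 : 'O_r(B) = 1.
    rewrite p_core_Fitting.
    have eF : 'O_r(G) = 'F(G) by rewrite -p_core_Fitting pcore_pgroup_id.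
    by have := trivg_pcore_quotient r G; rewrite /= eF.
  have /dprodP[_ defB _ _] := nilpotent_pcoreC r (Fitting_nil (G / 'F(G))).
  by rewrite -[X in pgroup _ X]defB rB1 mul1g pcore_pgroup.
have sBX : B \subset X / 'F(G) by apply: normal_sub_max_pgroup (Hall_max hallXF) _ _.
(* T is the copy of F(G/F) inside the tame group X; it inherits self-centralisation from G/F. *)
pose T := (X :&: coset 'F(G) @*^-1 B)%G.
have nsTX : T <| X.
  have nsBG : coset 'F(G) @*^-1 B <| coset 'F(G) @*^-1 (G / 'F(G)).
    by rewrite cosetpre_normal.
  by apply: normalGI sXG _; rewrite quotientGK in nsBG.
have sTX := normal_sub nsTX.
have nFT : T \subset 'N('F(G)) := subset_trans sTX nFX.
have defTB : T / 'F(G) = B.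
  apply/eqP; rewrite eqEsubset; apply/andP; split.
    by rewrite (sub_quotient_pre _ nFT) subsetIr.
  apply/subsetP=> b Bb; have /morphimP[x nFx Xx ex] := subsetP sBX b Bb.
  by rewrite ex mem_quotient // inE Xx mem_morphpre // -ex.
have tiFT : 'F(G) :&: T = 1 by apply/trivgP; rewrite -tiFX setIS.
have isoT : T \isog B by rewrite -defTB quotient_isog.
have nilT : nilpotent T by rewrite (isog_nil isoT) Fitting_nil.
have cXT : 'C_X(T) \subset T.
  apply/subsetP=> x /setIP[Xx cTx]; rewrite inE Xx mem_morphpre ?(subsetP nFX) //=.
  apply: (subsetP (solvable_cent_Fitting solH)); rewrite inE.
  rewrite mem_quotient ?(subsetP sXG) //= -cycle_subG -quotient_cycle ?(subsetP nFX) //.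
  by rewrite -/B -defTB quotient_cents // cycle_subG.
have regT : regular_on 'F(G) T.
  by split=> //; [apply: Fitting_nil | apply: semiregularS regF].
have ntX : X :!=: 1.
  apply: contraNneq nrG => X1; have := card_Hall hallX.
  rewrite X1 cards1 => /esym/eqP; rewrite partn_eq1 ?cardG_gt0 //.
  by rewrite pnatNK.
have ntT : T :!=: 1.
  apply: contraNneq ntX => T1; rewrite -subG1 -T1; apply: subset_trans cXT.
  by rewrite subsetI subxx T1 cents1.
have neq_r u : u \in X -> prime #[u] -> #[u] != r.
  by move=> Xu pu; have := mem_p_elt r'X Xu; rewrite /p_elt pnatE.
have fin : cyclic X -> X / 'F(G) = B -> exists m, case_cyclic_fpf G r #|X| m.
  by apply: Fitting_pgroup_cyclic.
have [[s s_pr sT]|npT] := pgroup_or_not T; last first.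
  have [a [b [pa pb nab defT]]] := tame_nilpotent (tameS sTX tX) nilT npT.
  have sXT : X \subset T := regular_on_pq regX tX nsTX pa pb nab defT.
  have eXT : X :=: T by apply/eqP; rewrite eqEsubset sXT.
  have [Ta Tb _] := dprod_cycle_mem defT.
  have [cycT oT] := dprod_prime_cycles pa pb nab defT.
  have [m] : exists m, case_cyclic_fpf G r #|X| m by apply: fin; rewrite eXT.
  rewrite eXT oT => case5; constructor 3; exists #[a], #[b], m; split=> //.
  rewrite /distinct_primes /= pa pb r_pr !inE negb_or nab.
  by rewrite !neq_r ?(subsetP sTX).
have [_ sdT _] := pgroup_pdiv sT ntT.
have [t Tt ot] := Cauchy s_pr sdT.
have nsr : s != r by rewrite -ot neq_r ?(subsetP sTX) // ot.
have [cycT|ncycT] := boolP (cyclic T).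
  have sX := regular_on_cyclic regX nsTX s_pr sT ntT cycT cXT.
  have cycB : cyclic B by rewrite -(isog_cyclic isoT).
  (* The derived subgroup of G/F centralises the cyclic B, so it lies in B and in X/F. Thus X/F is a
     normal s-subgroup, hence contained in B. *)
  have sH'B : (G / 'F(G))^`(1) \subset B.
    apply: subset_trans (solvable_cent_Fitting solH); rewrite subsetI der_sub /=.
    exact: der1_cent_cyclic cycB (normal_norm nsBH).
  have sXB : X / 'F(G) \subset B.
    apply: Fitting_max; last exact: pgroup_nil (quotient_pgroup _ sX).
    by apply: sub_der1_normal; rewrite ?quotientS // (subset_trans sH'B).
  have eXB : X / 'F(G) = B by apply/eqP; rewrite eqEsubset sXB.
  have cycX : cyclic X by rewrite (isog_cyclic (quotient_isog nFX tiFX)) /= eXB.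
  have [m case5] := fin cycX eXB; have [k oX] := p_natP sX.
  constructor 2; exists s, k, m; split; last by rewrite -oX.
  by rewrite /distinct_primes /= s_pr r_pr !inE nsr.
have [|[s2 [n n_gt2 isoQ]]] := regular_on_pgroup regT s_pr sT ntT.
  by rewrite (negPf ncycT).
rewrite s2 in sT s_pr; have [z oz O1T] := regular_on_Ohm1 regT s_pr sT ntT.
have twoX := regular_on_quaternion regX tX nsTX sT ncycT oz O1T.
constructor 1.
apply: (Fitting_pgroup_quaternion (n := n) solG tG r_pr rF ntF hallX twoX) => //.
  by rewrite -(isog_transl _ isoT).
by rewrite -(card_isog (isog_Ohm 1 isoT)) [X in #|_ X|]O1T -orderE.
Qed.

(** * The listed groups satisfy the commuting condition *)

Lemma two_primes_dvd_pq (s t c p q : nat) :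
  prime s -> prime t -> s != t -> prime p -> prime q ->
  s %| c -> t %| c -> c %| p * q -> c = (s * t)%N.
Proof.
move=> ps pt nst pp pq sc tc cpq.
have stc : s * t %| c by rewrite Gauss_dvd ?sc ?tc // prime_coprime // dvdn_prime2.
have no u : prime u -> c = u -> False.
  move=> pu cu; case/eqP: nst; move: sc tc; rewrite cu !dvdn_prime2 //.
  by move/eqP=> -> /eqP ->.
case: (dvdn_prime_mul pp pq cpq) => cE.
- by move: sc; rewrite cE dvdn1 => /eqP s1; rewrite s1 in ps.
- by case: (no p).
- by case: (no q).
have sd u : prime u -> u %| c -> u = p \/ u = q.
  by move=> pu; rewrite cE Euclid_dvdM // !dvdn_prime2 // => /orP[]/eqP; [left | right].
case: (sd s ps sc) (sd t pt tc) nst cE => -> [] -> ; rewrite ?eqxx // => _ -> //.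
by rewrite mulnC.
Qed.

(** The order bound forces C_G(b) = <bx>, cyclic of order |b||x|. Both clauses concern elements of
    C_G(b), where divisibility of orders settles them. *)
Lemma tame_pair_card_cent (gT : finGroupType) (G : {group gT}) (b x : gT) (p q : nat) :
  b \in G -> x \in G -> prime #[b] -> prime #[x] -> #[b] != #[x] -> commute b x ->
  prime p -> prime q -> #|'C_G[b]| %| p * q -> tame_pair G b x.
Proof.
move=> Gb Gx pb px nbx cbx pp pq dC.
have inC u : u \in G -> commute b u -> u \in 'C_G[b].
  by move=> Gu cbu; rewrite in_setI Gu; apply/cent1P.
have Cb := inC b Gb (commute_refl b); have Cx := inC x Gx cbx.
have oC := two_primes_dvd_pq pb px nbx pp pq (order_dvdG Cb) (order_dvdG Cx) dC.
have cobx : coprime #[b] #[x] by rewrite prime_coprime // dvdn_prime2.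
have defC : 'C_G[b] = <[b * x]>.
  apply/esym/eqP; rewrite eqEcard cycle_subG groupM //= oC -orderE.
  by rewrite orderM.
split=> [a Ga oa | y Gy py nyb cby].
  apply/negP=> ab; have Ca : a \in 'C_G[b].
    by apply: inC => //; case/cycleP: ab => i ->; apply/commute_sym/commuteX.
  have := order_dvdG Ca; rewrite oC oa expnS expn1 dvdn_pmul2l ?prime_gt0 //.
  by rewrite dvdn_prime2 // (negPf nbx).
have Cy := inC y Gy cby; rewrite defC in Cx Cy.
apply: (cycle_eq_order Cy Cx); have := order_dvd_cycle Cy.
rewrite orderM // Euclid_dvdM // !dvdn_prime2 // (negPf nyb) /=.
by move/eqP.
Qed.

Lemma card_cent1_dvd (gT : finGroupType) (G K : {group gT}) (b : gT) :
  K <| G -> 'C_K[b] = 1 -> #|'C_G[b]| %| #|G / K|.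
Proof.
move=> /andP[sKG nKG] cKb; have sCG := subsetIl G 'C[b].
have tiKC : K :&: 'C_G[b] = 1 by rewrite setIA (setIidPl sKG).
rewrite (card_isog (quotient_isog (subset_trans sCG nKG) tiKC)).
by rewrite cardSg // quotientS.
Qed.

Lemma semiregular_cent1_ker (gT : finGroupType) (G K Q : {group gT}) (k : gT) :
  K ><| Q = G -> semiregular K Q -> k \in K -> k != 1 -> 'C_G[k] \subset K.
Proof.
move=> defG regQ Kk ntk; have [Q1|ntQ] := eqVneq (Q : {set gT}) 1.
  by have [_ <- _ _] := sdprodP defG; rewrite Q1 mulg1 subsetIl.
have ntK : K :!=: 1 by apply: contraNneq ntk => K1; rewrite -in_set1 -[[set 1]]K1.
have frobG := introT (Frobenius_semiregularP defG ntK ntQ) regQ.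
by apply: (Frobenius_cent1_ker frobG); rewrite !inE ntk.
Qed.

(** For [b] in K, C_G(b) lies in K, of order pq. For [b] outside K, C_K(b) = 1, so |C_G(b)| divides
    |Q|: a prime power excludes the commuting [x], and a product of two primes falls under
    [tame_pair_card_cent]. *)
Lemma semiregular_tame_pair (gT : finGroupType) (G K Q : {group gT}) (p q : nat)
    (b x : gT) :
  K ><| Q = G -> semiregular K Q -> prime p -> prime q -> #|K| = (p * q)%N ->
  (exists2 r : nat, prime r & r.-group Q) \/
  (exists r s : nat, [/\ prime r, prime s & #|Q| = (r * s)%N]) ->
  b \in G -> x \in G -> prime #[b] -> prime #[x] -> #[b] != #[x] -> commute b x ->
  tame_pair G b x.
Proof.
move=> defG regQ pp pq oK typeQ Gb Gx pb px nbx cbx.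
have [nsKG _ mulKQ nKQ tiKQ] := sdprod_context defG.
have ntb : b != 1 by rewrite -order_gt1 prime_gt1.
have [Kb|nKb] := boolP (b \in K).
  apply: (tame_pair_card_cent (p := p) (q := q)) => //; rewrite -oK cardSg //.
  exact: semiregular_cent1_ker defG regQ Kb ntb.
have cKb : 'C_K[b] = 1.
  apply/trivgP/subsetP=> k /setIP[Kk cbk]; rewrite inE; apply: contraR nKb => ntk.
  have := subsetP (semiregular_cent1_ker defG regQ Kk ntk); apply.
  by rewrite in_setI Gb cent1C.
have dC : #|'C_G[b]| %| #|Q|.
  by rewrite (card_isog (sdprod_isog defG)) card_cent1_dvd.
case: typeQ => [[r r_pr rQ]|[r [s [r_pr s_pr oQ]]]]; last first.
  by apply: (tame_pair_card_cent (p := r) (q := s)) => //; rewrite -oQ.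
have isr u : u \in G -> prime #[u] -> commute b u -> #[u] = r.
  move=> Gu pu cbu; have Cu : u \in 'C_G[b] by rewrite in_setI Gu; apply/cent1P.
  apply/eqP; have := pnat_dvd (dvdn_trans (order_dvdG Cu) dC) rQ.
  by rewrite pnatE.
by case/eqP: nbx; rewrite (isr b) // (isr x).
Qed.

Lemma pgroup_tame (gT : finGroupType) (G : {group gT}) (r : nat) :
  prime r -> r.-group G -> tame G.
Proof.
move=> r_pr rG b x Gb Gx pb px nbx _.
have isr u : u \in G -> prime #[u] -> #[u] = r.
  by move=> Gu pu; apply/eqP; have := mem_p_elt rG Gu; rewrite /p_elt pnatE.
by case/eqP: nbx; rewrite (isr b) // (isr x).
Qed.

Lemma case_pq_by_r_tame (gT : finGroupType) (G : {group gT}) (p q r n : nat) :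
  distinct_primes [:: p; q; r] -> case_pq_by_r G p q r n -> tame G.
Proof.
case/andP=> /and4P[pp pq pr _] _ [K [Q [/andP[_ /eqP oK] /andP[_ /eqP oQ] defG regQ]]].
have reg : semiregular K Q.
  case: n oQ regQ => [|n] oQ regQ; last exact: regQ.
  by move: (card1_trivg oQ) => ->; apply: semiregular1r.
move=> b x Gb Gx pb px nbx cbx.
apply: (semiregular_tame_pair defG reg pp pq oK) => //.
by left; exists r; rewrite // /pgroup oQ pnatX pnat_id.
Qed.

Lemma case_rs_by_pq_tame (gT : finGroupType) (G : {group gT}) (p q r s : nat) :
  distinct_primes [:: p; q; r; s] -> case_rs_by_pq G p q r s -> tame G.
Proof.
case/andP=> /and5P[pp pq pr ps _] _.
case=> _ _ [K [Q [/andP[_ /eqP oK] /andP[_ /eqP oQ] defG regQ]]].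
move=> b x Gb Gx pb px nbx cbx.
by apply: (semiregular_tame_pair defG regQ pr ps oK) => //; right; exists p, q.
Qed.

(** There is no commuting pair of distinct prime orders: such a [b] would lie outside F, so |C_G(b)|
    would divide a power of 2. *)
Lemma case_quaternion_tame (gT : finGroupType) (G : {group gT}) (r : nat) :
  prime r -> r.-group 'F(G) -> case_quaternion G -> tame G.
Proof.
move=> r_pr rF [[n [n_gt2 isoQ]] fpf] b x Gb Gx pb px nbx cbx; exfalso.
have nsFG := Fitting_normal G.
have oH : #|G / 'F(G)| = (2 ^ n)%N.
  by rewrite (card_isog isoQ) card_quaternion.
have notF u v : u \in G -> v \in G -> prime #[u] -> prime #[v] -> #[u] != #[v] ->
    commute u v -> u \notin 'F(G).
  move=> Gu Gv pu pv nuv cuv; apply/negP=> Fu.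
  have our : #[u] = r by apply/eqP; have := mem_p_elt rF Fu; rewrite /p_elt pnatE.
  have [Fv|nFv] := boolP (v \in 'F(G)).
    case/eqP: nuv; rewrite our; apply/esym/eqP.
    by have := mem_p_elt rF Fv; rewrite /p_elt pnatE.
  have : u \in 'C_('F(G))[v] by rewrite in_setI Fu; apply/cent1P.
  by rewrite fpf ?inE ?nFv // => u1; rewrite (eqP u1) order1 in pu.
have nFb := notF b x Gb Gx pb px nbx cbx.
have cFb : 'C_('F(G))[b] = 1 by apply: fpf; rewrite inE nFb.
have dC := card_cent1_dvd nsFG cFb; rewrite oH in dC.
have is2 u : u \in G -> prime #[u] -> commute b u -> #[u] = 2.
  move=> Gu pu cbu; have Cu : u \in 'C_G[b] by rewrite in_setI Gu; apply/cent1P.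
  have := dvdn_trans (order_dvdG Cu) dC; rewrite Euclid_dvdX // dvdn_prime2 //.
  by case/andP=> /eqP.
by case/eqP: nbx; rewrite (is2 b) // (is2 x).
Qed.

(** If |b| = p, then C_G(b) lies in KZ, of order pq. If |b| = q, no such bound holds: uniqueness
    comes from K being the only subgroup of order p, and the root clause from locating [b] in the
    direct factor Z. *)
Lemma case_pq_times_q_tame (gT : finGroupType) (G : {group gT}) (p q n : nat) :
  distinct_primes [:: p; q] -> case_pq_times_q G p q n -> tame G.
Proof.
case/andP=> /and3P[pp pq _]; rewrite /= andbT inE => npq.
case=> K [Q [L [Z [[/andP[_ /eqP oK] /andP[_ /eqP oQ] defL]
                   [/andP[_ /eqP oZ] defG regQ]]]]].
have [_ mulG cLZ tiLZ] := dprodP defG.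
have [nsKL sQL mulL nKQ tiKQ] := sdprod_context defL.
have [sLG sZG] : L \subset G /\ Z \subset G by rewrite -mulG mulG_subl mulG_subr.
have sKL := normal_sub nsKL; have sKG := subset_trans sKL sLG.
have nsKG : K <| G.
  rewrite /normal sKG -mulG mul_subG ?(normal_norm nsKL) //.
  exact: subset_trans cLZ (subset_trans (centS sKL) (cent_sub K)).
have pK : p.-group K by rewrite /pgroup oK pnat_id.
have oG : #|G| = (p * q ^ n.+1)%N.
  by rewrite -(dprod_card defG) -(sdprod_card defL) oK oQ oZ expnSr mulnA.
have p'q : p^'.-nat (q ^ n.+1)%N by rewrite pnatX pnatE // !inE eq_sym npq.
have hallK : p.-Hall(G) K.
  rewrite pHallE sKG oK oG partnM ?expn_gt0 ?(prime_gt0 pp) ?(prime_gt0 pq) //=.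
  by rewrite [X in (X * _)%N]part_pnat_id ?pnat_id // part_p'nat // muln1.
(* The hypothesis is about O_p(F(G)) = O_p(G), which is the normal Hall subgroup K; for n = 0 the
   group Q is trivial. *)
have reg : semiregular K Q.
  case: n oQ regQ {oG p'q} => [|n] oQ regQ.
    by move: (card1_trivg oQ) => ->; apply: semiregular1r.
  have := regQ isT; rewrite p_core_Fitting (normal_Hall_pcore hallK nsKG).
  exact.
have orders u : u \in G -> prime #[u] -> #[u] = p \/ #[u] = q.
  move=> Gu pu; have := order_dvdG Gu; rewrite oG Euclid_dvdM // Euclid_dvdX //.
  by rewrite !dvdn_prime2 // andbT => /orP[]/eqP; [left | right].
have inK u : u \in G -> #[u] = p -> u \in K.
  by move=> Gu ou; rewrite (mem_normal_Hall hallK nsKG Gu) /p_elt ou pnat_id.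
have eqK u : u \in G -> #[u] = p -> <[u]> = K.
  move=> Gu ou; apply/eqP; rewrite eqEcard cycle_subG inK //= oK -orderE ou //.
have sCK u : u \in G -> #[u] = p -> 'C_G[u] \subset K * Z.
  move=> Gu ou; apply/subsetP=> g /setIP[Gg cug].
  have Ku := inK u Gu ou; have ntu : u != 1 by rewrite -order_gt1 ou prime_gt1.
  have [l [z [Ll Zz eg _]]] := mem_dprod defG Gg; rewrite eg mem_mulg //.
  have cKz : commute u z.
    by apply/esym/(centsP cLZ) => //; apply: (subsetP sKL).
  apply: (subsetP (semiregular_cent1_ker defL reg Ku ntu)); rewrite in_setI Ll.
  have -> : l = g * z^-1 by rewrite eg mulgK.
  apply/cent1P/commute_sym/commuteM; last exact: commuteV.
  by apply/commute_sym/cent1P.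
have cKZ : Z \subset 'C(K) := subset_trans cLZ (centS sKL).
have oKZ : #|K <*> Z| = (p * q)%N.
  rewrite cent_joinEr // TI_cardMg ?oK ?oZ //.
  by apply/trivgP; rewrite -tiLZ setSI.
move=> b x Gb Gx pb px nbx cbx.
have [ob|ob] := orders b Gb pb.
  apply: (tame_pair_card_cent (p := p) (q := q)) => //.
  by rewrite -oKZ cardSg //= cent_joinEr // sCK.
have ox : #[x] = p.
  by have [//|ox] := orders x Gx px; rewrite ob ox eqxx in nbx.
(* In b = kz the order of k divides p, and b^q = z^q = 1 makes it divide q. *)
have Zb : b \in Z.
  have : b \in 'C_G[x] by rewrite in_setI Gb; apply/cent1P.
  move/(subsetP (sCK x Gx ox))/mulsgP=> [k z Kk Zz eb].
  have ckz : commute k z by apply/esym/(centsP cKZ).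
  suffices k1 : k = 1 by rewrite eb k1 mul1g.
  apply/eqP; rewrite -order_eq1 -dvdn1.
  have dkp : #[k] %| p by rewrite -oK order_dvdG.
  have dkq : #[k] %| q.
    have bq : b ^+ q = 1 by rewrite -ob expg_order.
    have zq : z ^+ q = 1 by apply/eqP; rewrite -order_dvdn -oZ order_dvdG.
    by rewrite order_dvdn; move: bq; rewrite eb expgMn // zq mulg1 => ->.
  have copq : coprime p q by rewrite prime_coprime // dvdn_prime2.
  by rewrite -(eqnP copq) dvdn_gcd dkp.
split=> [a Ga oa | y Gy py nyb _]; last first.
  have [oy|oy] := orders y Gy py; first by rewrite !eqK.
  by rewrite oy ob eqxx in nyb.
apply/negP=> ab; rewrite ob in oa.
have oaq : #[a ^+ q] = q.
  by rewrite orderXdiv oa ?dvdn_exp // expnS expn1 mulnK ?prime_gt0.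
have ebaq : <[b]> = <[a ^+ q]>.
  by apply: (cycle_eq_order ab); rewrite ?mem_cycle ?ob.
have [l [z [Ll Zz ea _]]] := mem_dprod defG Ga.
have clz : commute l z by apply/esym/(centsP cLZ).
have zq : z ^+ q = 1 by apply/eqP; rewrite -order_dvdn -oZ order_dvdG.
(* Z has exponent q, so a^q lies in L; it generates <b>, and L :&: Z = 1. *)
have Lb : b \in L.
  rewrite -cycle_subG ebaq cycle_subG ea expgMn // zq mulg1.
  exact: groupX.
have : b \in L :&: Z by rewrite inE Lb.
rewrite tiLZ => /set1P b1; move: pb.
by rewrite b1 order1.
Qed.

(* [<x>] and [<y>] are both Sylow in [F <x>]. *)
Lemma cent1_coset_trivial (gT : finGroupType) (F : {group gT}) (r : nat) (x y : gT) :
  r.-group F -> prime #[x] -> #[x] != r -> x \in 'N(F) -> y \in 'N(F) ->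
  #[x].-elt y -> coset F y = coset F x -> 'C_F[y] = 1 -> 'C_F[x] = 1.
Proof.
move=> rF px nxr nFx nFy py exy cFy.
set M := (F <*> <[x]>)%G.
have sFM : F \subset M by apply: joing_subl.
have sxM : <[x]> \subset M by apply: joing_subr.
have nFxs : <[x]> \subset 'N(F) by rewrite cycle_subG.
have r'x : r^'.-group <[x]> by rewrite /pgroup -orderE pnatE // !inE.
have oM : #|M| = (#|F| * #[x])%N.
  by rewrite /M /= norm_joinEr // TI_cardMg // coprime_TIg // (pnat_coprime rF).
have My : y \in M.
  have : coset F y \in M / F by rewrite exy mem_quotient // -cycle_subG.
  case/morphimP=> m nFm Mm /rcoset_kercosetP; case/(_ nFy nFm)/rcosetP=> f Ff ->.
  by rewrite groupM // (subsetP sFM).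
have x'F : #[x]^'.-group F by apply: (pi_pnat rF); rewrite !inE eq_sym.
have sylx : #[x].-Sylow(M) <[x]>.
  rewrite pHallE sxM -orderE oM partnM ?cardG_gt0 ?(prime_gt0 px) //=.
  by rewrite (part_p'nat x'F) part_pnat_id ?pnat_id // mul1n.
have syM : <[y]> \subset M by rewrite cycle_subG.
have [c Mc yc] := Sylow_subJ sylx syM py.
have nFc : c \in 'N(F).
  by apply: subsetP Mc; rewrite join_subG normG.
apply/trivgP/subsetP=> f /setIP[Ff /cent1P cfx]; rewrite inE -(conjg_eq1 f c).
have : f ^ c \in 'C_F[y]; last by rewrite cFy inE.
rewrite in_setI memJ_norm // Ff; apply/cent1P.
have : y \in <[x]> :^ c by rewrite -cycle_subG.
rewrite -cycleJ => /cycleP[i ->]; apply: commuteX.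
by rewrite /commute -!conjMg cfx.
Qed.

Section CyclicFpf.

Variables (gT hT : finGroupType) (G : {group gT}) (r n m : nat).
Variables (A : {group {perm gT}}) (L K R : {group hT}).
Variables (psi : {morphism A >-> hT}) (phi : {morphism G / 'F(G) >-> hT}).
Hypotheses (r_pr : prime r) (rF : r.-group 'F(G)) (co_rn : coprime r n).
Hypotheses (fpfA : fpf_automorphism_group 'F(G) A) (oA : #|A| = n).
Hypotheses (defL : K ><| R = L) (oR : #|R| = (r ^ m)%N).
Hypotheses (isoA : isom A K psi) (regR : 0 < m -> semiregular K R).
Hypotheses (injphi : 'injm phi) (sHL : phi @* (G / 'F(G)) \subset L).
Hypothesis actA : forall (a : {perm gT}) (h : coset_of 'F(G)),
  a \in A -> h \in G / 'F(G) -> phi h = psi a ->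
  exists g : gT, [/\ g \in G, coset 'F(G) g = h
                  & {in 'F(G), forall x, x ^ g = a x}].

Let oK : #|K| = n.
Proof. by have /isomP[injpsi <-] := isoA; rewrite card_injm. Qed.

Let semiregKR : semiregular K R.
Proof.
case: m oR regR => [|m'] oR' regR'; last exact: regR'.
by move: (card1_trivg oR') => ->; apply: semiregular1r.
Qed.

(** K is the normal Hall r'-subgroup of L, so the image of [x] is some psi(a). [actA] only provides
    one representative g acting as a; its |x|-part still acts as a and shares the coset of [x], so
    [cent1_coset_trivial] transfers the absence of fixed points to [x]. *)
Lemma phi_coset_kernel x :
  x \in G -> prime #[x] -> #[x] != r ->
  [/\ phi (coset 'F(G) x) \in K, #[coset 'F(G) x] = #[x]
    & 'C_('F(G))[x] = 1].
Proof.
move=> Gx px nxr; have nsFG := Fitting_normal G.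
have nFx : x \in 'N('F(G)) := subsetP (normal_norm nsFG) x Gx.
set h := coset 'F(G) x; have Hh : h \in G / 'F(G) by rewrite mem_quotient.
have oh : #[h] = #[x].
  have : #[h] %| #[x] := morph_order (coset_morphism 'F(G)) nFx.
  have /primeP[_ dx] := px; move/dx=> /orP[|/eqP//].
  rewrite order_eq1 => /eqP/(coset_idr nFx) Fx.
  by have := mem_p_elt rF Fx; rewrite /p_elt pnatE // inE (negPf nxr).
have [nsKL _ _ _ _] := sdprod_context defL.
have hallK : r^'.-Hall(L) K.
  have r'n : r^'.-nat #|K| by rewrite oK p'natE // -prime_coprime.
  rewrite pHallE normal_sub //= -(sdprod_card defL) partnM ?cardG_gt0 //.
  by rewrite (part_pnat_id r'n) oR part_p'nat ?muln1 // pnatNK pnatX pnat_id.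
have r'h : r^'.-elt (phi h).
  by rewrite /p_elt (order_injm injphi Hh) oh pnatE // !inE.
have Lh : phi h \in L by rewrite (subsetP sHL) // mem_morphim.
have Kh : phi h \in K by rewrite (mem_normal_Hall hallK nsKL Lh).
split=> //; have /isomP[injpsi defK] := isoA.
have [a Aa ea] : exists2 a, a \in A & phi h = psi a.
  by move: Kh; rewrite -defK => /morphimP[a Aa _ ->]; exists a.
have [g [Gg eg actg]] := actA Aa Hh ea.
have nFg : g \in 'N('F(G)) := subsetP (normal_norm nsFG) g Gg.
have oa : #[a] = #[x] by rewrite -(order_injm injpsi Aa) -ea (order_injm injphi Hh).
have [sAAut fpf] := fpfA.
have eqa : conj_aut 'F(G) g = a.
  apply: (@eq_Aut _ 'F(G)); last by move=> u Fu; rewrite norm_conj_autE ?actg.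
    by apply: (subsetP (Aut_conj_aut 'F(G) <[g]>)); rewrite mem_morphim ?cycle_id.
  exact: (subsetP sAAut).
set y := g.`_(#[x]).
have nFy : y \in 'N('F(G)) by rewrite groupX.
have xa : #[x].-elt a by rewrite /p_elt oa pnat_id.
have xh : #[x].-elt h by rewrite /p_elt oh pnat_id.
apply: (cent1_coset_trivial (y := y) rF) => //; first exact: p_elt_constt.
  by rewrite morph_constt //= eg constt_p_elt.
have eqy : conj_aut 'F(G) y = a.
  by rewrite morph_constt //= [in LHS]eqa constt_p_elt.
apply/trivgP/subsetP=> u /setIP[Fu /cent1P cuy]; rewrite inE.
apply/eqP; apply: (fpf a) => //.
  rewrite !inE Aa andbT -order_eq1 oa; by case: (#[x]) px => [|[]].
rewrite -eqy norm_conj_autE //; apply/conjg_fixP/commgP; exact: cuy.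
Qed.

(** C_G(x) meets F trivially, so it embeds through [phi] in the centraliser of a nontrivial element
    of K, which lies in K. *)
Lemma fpf_card_cent1 x :
  x \in G -> prime #[x] -> #[x] != r -> #|'C_G[x]| %| n.
Proof.
move=> Gx px nxr; have [Kh oh cFx] := phi_coset_kernel Gx px nxr.
have nsFG := Fitting_normal G; have nFG := normal_norm nsFG.
have sCG := subsetIl G 'C[x]; have sCN := subset_trans sCG nFG.
have tiFC : 'F(G) :&: 'C_G[x] = 1.
  by rewrite setIA (setIidPl (normal_sub nsFG)).
have sCH : 'C_G[x] / 'F(G) \subset G / 'F(G) by rewrite quotientS.
rewrite (card_isog (quotient_isog sCN tiFC)) -(card_injm injphi sCH) -oK.
rewrite cardSg //; apply: subset_trans (_ : 'C_L[phi (coset 'F(G) x)] \subset _).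
  apply/subsetP=> _ /morphimP[hc Hc /morphimP[c nFc /setIP[Gc ccx] ec] ->].
  rewrite {hc}ec in Hc *.
  rewrite in_setI (subsetP sHL) ?mem_morphim //=.
  have Hx : coset 'F(G) x \in G / 'F(G) by rewrite mem_quotient.
  have nFx := subsetP nFG x Gx.
  have := congr1 (coset 'F(G)) (cent1P ccx); rewrite !morphM //= => ccxF.
  by apply/cent1P; have := congr1 phi ccxF; rewrite !morphM.
apply: (semiregular_cent1_ker defL semiregKR Kh).
by rewrite -order_gt1 (order_injm injphi) ?oh ?prime_gt1 // mem_quotient.
Qed.

Lemma fpf_orders b x :
  b \in G -> x \in G -> prime #[b] -> prime #[x] -> #[b] != #[x] -> commute b x ->
  #[b] != r.
Proof.
move=> Gb Gx pb px nbx cbx; apply/eqP=> ebr.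
have nxr : #[x] != r by rewrite -ebr eq_sym.
have Cb : b \in 'C_G[x] by rewrite in_setI Gb; apply/cent1P.
have := dvdn_trans (order_dvdG Cb) (fpf_card_cent1 Gx px nxr).
by rewrite ebr => rn; move: co_rn; rewrite prime_coprime // rn.
Qed.

End CyclicFpf.

Lemma case_cyclic_fpf_card_cent1 (gT : finGroupType) (G : {group gT}) (r n m : nat)
    (b x : gT) :
  prime r -> r.-group 'F(G) -> coprime r n -> case_cyclic_fpf G r n m ->
  b \in G -> x \in G -> prime #[b] -> prime #[x] -> #[b] != #[x] -> commute b x ->
  #|'C_G[b]| %| n.
Proof.
move=> r_pr rF co_rn [A [fpfA /andP[_ /eqP oA]]].
case=> hT [L [K [R [psi [phi [[defL /andP[_ /eqP oR] isoA regR] emb]]]]]].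
case: emb => injphi sHL actA.
move=> Gb Gx pb px nbx cbx.
have nbr := fpf_orders r_pr rF co_rn fpfA oA defL oR isoA regR injphi sHL actA
  Gb Gx pb px nbx cbx.
exact: (fpf_card_cent1 r_pr rF co_rn fpfA oA defL oR isoA regR injphi sHL actA Gb).
Qed.

Lemma case_cyclic_fpf_prime_power_tame (gT : finGroupType) (G : {group gT})
    (r p k m : nat) :
  prime r -> r.-group 'F(G) -> distinct_primes [:: p; r] ->
  case_cyclic_fpf G r (p ^ k)%N m -> tame G.
Proof.
move=> r_pr rF; case/andP=> /and3P[p_pr _ _]; rewrite /= andbT inE => npr case5.
have co : coprime r (p ^ k).
  by rewrite coprimeXr // prime_coprime // dvdn_prime2 // eq_sym.
move=> b x Gb Gx pb px nbx cbx; exfalso.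
have dC := case_cyclic_fpf_card_cent1 r_pr rF co case5 Gb Gx pb px nbx cbx.
have isp u : u \in G -> prime #[u] -> commute b u -> #[u] = p.
  move=> Gu pu cbu; have Cu : u \in 'C_G[b] by rewrite in_setI Gu; apply/cent1P.
  have := dvdn_trans (order_dvdG Cu) dC; rewrite Euclid_dvdX // dvdn_prime2 //.
  by case/andP=> /eqP.
by case/eqP: nbx; rewrite (isp b) // (isp x).
Qed.

Lemma case_cyclic_fpf_pq_tame (gT : finGroupType) (G : {group gT}) (r p q m : nat) :
  prime r -> r.-group 'F(G) -> distinct_primes [:: p; q; r] ->
  case_cyclic_fpf G r (p * q)%N m -> tame G.
Proof.
move=> r_pr rF; case/andP=> /and4P[p_pr q_pr _ _].
rewrite /= !inE negb_or andbT => /andP[/andP[npq npr] nqr] case5.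
have co : coprime r (p * q).
  by rewrite coprimeMr !prime_coprime // !dvdn_prime2 // !(eq_sym r) npr.
move=> b x Gb Gx pb px nbx cbx.
apply: (tame_pair_card_cent (p := p) (q := q)) => //.
exact: case_cyclic_fpf_card_cent1 r_pr rF co case5 Gb Gx pb px nbx cbx.
Qed.

(** Q acts semiregularly on the subgroup of each prime order u in the cyclic K, so its nontrivial
    orbits there have length |Q|. *)
Lemma case_pq_by_r_dvd (gT : finGroupType) (G : {group gT}) (p q r n : nat) :
  distinct_primes [:: p; q; r] -> 0 < n -> case_pq_by_r G p q r n ->
  (r ^ n %| q - 1)%N /\ (r ^ n %| p - 1)%N.
Proof.
case/andP=> /and4P[pp pq pr _] _ n_gt0.
case=> K [Q [/andP[cycK /eqP oK] /andP[_ /eqP oQ] defG /(_ n_gt0) regQ]].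
have [_ _ _ nKQ _] := sdprod_context defG.
have dvd u : prime u -> u %| p * q -> r ^ n %| u - 1.
  rewrite -oK -oQ subn1 => pu /(Cauchy pu)[k Kk ok].
  rewrite -ok [#[k]]orderE; apply: regular_norm_dvd_pred.
    by apply: char_norm_trans nKQ; rewrite sub_cyclic_char // cycle_subG.
  by apply: semiregularS regQ; rewrite ?cycle_subG.
by split; apply: dvd => //; [apply: dvdn_mull | apply: dvdn_mulr].
Qed.

Theorem theorem1p2 (gT : finGroupType) (G : {group gT}) (solG : solvable G) :
  (cograph G (@pow_adj gT) <->
     has_prime_power_order G
  \/ (exists p q n : nat,
        distinct_primes [:: p; q] /\ case_pq_times_q G p q n)
  \/ (exists p q r n : nat,
        distinct_primes [:: p; q; r] /\ case_pq_by_r G p q r n)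
  \/ (exists p q r s : nat,
        distinct_primes [:: p; q; r; s] /\ case_rs_by_pq G p q r s)
  \/ (exists r : nat,
        [/\ prime r, r.-group 'F(G)
          & [\/ case_quaternion G,
                (exists p k m : nat,
                   distinct_primes [:: p; r] /\ case_cyclic_fpf G r (p ^ k)%N m)
              | (exists p q m : nat,
                   distinct_primes [:: p; q; r] /\
                   case_cyclic_fpf G r (p * q)%N m)]]))
  /\ (forall p q r n : nat,
        distinct_primes [:: p; q; r] -> (0 < n)%N -> case_pq_by_r G p q r n ->
        (r ^ n %| q - 1)%N /\ (r ^ n %| p - 1)%N).
Proof.
split; last by move=> p q r n; apply: case_pq_by_r_dvd.
split=> [/cograph_tame tG | cases].
  have [[r r_pr rF]|npF] := pgroup_or_not 'F(G); last first.
    right; have [|[|]] := Fitting_not_pgroup_cases solG tG npF => H.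
    - by left.
    - by right; left.
    by right; right; left.
  have [rG|nrG] := boolP (r.-group G).
    by left; have [k oG] := p_natP rG; exists r, k.
  by right; right; right; right; exists r; split=> //; apply: Fitting_pgroup_cases.
apply: tame_cograph; case: cases => [[p [k [p_pr oG]]]|].
  by apply: (pgroup_tame p_pr); rewrite /pgroup oG pnatX pnat_id.
case=> [[p [q [n [pq]]]]|]; first exact: case_pq_times_q_tame.
case=> [[p [q [r [n [pqr]]]]]|]; first exact: case_pq_by_r_tame.
case=> [[p [q [r [s [pqrs]]]]]|]; first exact: case_rs_by_pq_tame.
case=> r [r_pr rF []].
- exact: case_quaternion_tame r_pr rF.
- by case=> p [k [m [pr]]]; apply: (case_cyclic_fpf_prime_power_tame r_pr rF).
by case=> p [q [m [pqr]]]; apply: (case_cyclic_fpf_pq_tame r_pr rF).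
Qed.
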